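(* Let $G\subseteq R_k$ contain all unary predicates $\rho_{=,a}$ ($a\in E_k$), suppose the set of essential predicates in $[G]$ is finite, let $p$ be the maximal arity of an essential predicate in $[G]$ and let $q=ar(G)$ (a finite number). Then there exist an essential predicate $\rho\in[G]$ of some arity $n$ and predicates $\rho_1,\dots,\rho_n\in[G]$ such that $$\rho(x_1,\dots,x_n)=\exists y_1\dots\exists y_{n-1}\;\rho_1(x_1,y_1)\wedge\rho_2(y_1,x_2,y_2)\wedge\rho_3(y_2,x_3,y_3)\wedge\dots\wedge\rho_{n-1}(y_{n-2},x_{n-1},y_{n-1})\wedge\rho_n(y_{n-1},x_n)$$ and $n=ar(\rho)>\log_{k\cdot q}(p)$.
   Context: $E_k=\{0,\dots,k-1\}$, $k\ge2$; $R_k$ is the set of all predicates $E_k^n\to\{0,1\}$, $n\ge0$. $\rho_{=,a}$ is the unary predicate true exactly at $a$. $ar(G)$ is the maximal arity of a predicate in $G$ (taken to be $\infty$ if $G$ is infinite). For $S\subseteq R_k$, $[S]$ is the set of all predicates expressible by a formula $\exists y_1\dots\exists y_l$ (conjunction of atoms $\rho_i(z_{i,1},\dots,z_{i,n_i})$) with $\rho_i\in S\cup\{=,\mathrm{false}\}$ ($=$ binary equality, $\mathrm{false}$ the $0$-ary predicate with value $0$). A predicate of arity $n$ is essential if it cannot be written as a conjunction of predicates of arity $<n$ each applied to pairwise distinct variables among its $n$ variables. *)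

(* Defs.v *)
From HB Require Import structures.
From mathcomp Require Import all_boot all_order all_algebra.
From mathcomp Require Import boolp classical_sets functions cardinality.
From mathcomp Require Import reals exp.

Set Implicit Arguments.
Unset Strict Implicit.
Unset Printing Implicit Defensive.

Import Order.TTheory GRing.Theory Num.Theory.

Local Open Scope classical_set_scope.

(* E_k is 'I_k. Predicates are finite functions, so Leibniz equality is
   extensional equality. *)
Definition rpred (k n : nat) := {ffun n.-tuple 'I_k -> bool}.

Definition Rk (k : nat) := {n : nat & rpred k n}.

Definition mkRk (k n : nat) (r : rpred k n) : Rk k := Tagged (rpred k) r.

Definition arity (k : nat) (P : Rk k) : nat := tag P.

Definition rel_of (k : nat) (P : Rk k) : rpred k (arity P) := tagged P.

Definition rho_eq_const (k : nat) (a : 'I_k) : Rk k :=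
  mkRk [ffun t : 1.-tuple 'I_k => thead t == a].

Definition rho_eq (k : nat) : Rk k :=
  mkRk [ffun t : 2.-tuple 'I_k => tnth t ord0 == tnth t ord_max].

Definition rho_false (k : nat) : Rk k :=
  mkRk [ffun t : 0.-tuple 'I_k => false].

(* For fixed k there are finitely many predicates of each arity, so an infinite
   set has unbounded arities: [is_ar S m] says that ar(S) is the finite
   number m. *)
Definition is_ar (k : nat) (S : set (Rk k)) (m : nat) : Prop :=
  (exists2 P, S P & arity P = m) /\ (forall P, S P -> arity P <= m).

Record atom (k : nat) (V : Type) := Atom {
  atom_pred : Rk k;
  atom_vars : (arity atom_pred).-tuple V
}.

Definition atom_holds (k : nat) (V : Type) (v : V -> 'I_k) (a : atom k V)
    : bool :=
  rel_of (atom_pred a) (map_tuple v (atom_vars a)).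

Definition conj_holds (k : nat) (V : Type) (m : nat) (a : 'I_m -> atom k V)
    (v : V -> 'I_k) : bool :=
  [forall i, atom_holds v (a i)].

(* Free variables x_1, ..., x_n are the left summand, bound variables
   y_1, ..., y_l the right one. *)
Definition assign (k n l : nat) (x : n.-tuple 'I_k) (y : l.-tuple 'I_k)
    (z : 'I_n + 'I_l) : 'I_k :=
  match z with inl i => tnth x i | inr j => tnth y j end.

(* The set [S] of predicates expressible over S. *)
Definition pp_closure (k : nat) (S : set (Rk k)) : set (Rk k) :=
  [set P | exists (l m : nat) (a : 'I_m -> atom k ('I_(arity P) + 'I_l)),
     (forall i, (S `|` [set rho_eq k; rho_false k]) (atom_pred (a i))) /\
     (forall x, rel_of P x =
        [exists y : l.-tuple 'I_k, conj_holds a (assign x y)])].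

(* The conjuncts range over all of R_k. *)
Definition essential (k : nat) (P : Rk k) : Prop :=
  ~ exists (m : nat) (a : 'I_m -> atom k 'I_(arity P)),
      (forall i, arity (atom_pred (a i)) < arity P /\ uniq (atom_vars (a i))) /\
      (forall x, rel_of P x = conj_holds a (tnth x)).

(* The chain for n = m + 2, with indices starting from 0: [r1] is rho_1,
   [r i] (i < m) is rho_{i+2}, and [rn] is rho_n. All uses of [inord] are in
   range. *)
Definition chain (k m : nat) (r1 : rpred k 2) (r : 'I_m -> rpred k 3)
    (rn : rpred k 2) (x : (m.+2).-tuple 'I_k) : bool :=
  [exists y : (m.+1).-tuple 'I_k,
     [&& r1 [tuple tnth x ord0; tnth y ord0],
         [forall i : 'I_m,
            r i [tuple tnth y (inord i); tnth x (inord i.+1);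
                       tnth y (inord i.+1)]] &
         rn [tuple tnth y ord_max; tnth x ord_max]]].

Definition logb (R : realType) (b x : R) : R := (ln x / ln b)%R.

(* Main.v *)
(* A predicate is essential iff it has a critical tuple: one refuted by it, but
   accepted after a suitable change of any single coordinate. Fix a pp-formula
   with p critical leaves x_i = a_i, where p is maximal.

   If an equality u = v of the formula is dropped, what remains is a digraph on
   E_k without loops. By maximality of p this digraph has no cycle (on the
   vertices that become loops when all leaves are released): a cycle would give
   arbitrarily long unsatisfiable walks in which every edge needs a leaf of its
   own. So the loop u = v can be unfolded into a finite walk of copies of the
   formula, still unsatisfiable, and again by maximality a critical set of
   leaves of the unfolding contains exactly one copy of each x_i. Repeating
   this for all equalities yields an acyclic formula with p critical leaves.

   In an acyclic formula every branching (a conjunction at a variable, or an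
   atom of arity at most max(q, 2)) splits the leaves into at most k * q parts;
   following the part with the longest chain and keeping one leaf of another
   part at each branching gives a chain with n leaves where p <= (kq)^(n-1). *)
Require Import Defs.
From HB Require Import structures.
From mathcomp Require Import all_boot.
From mathcomp Require Import boolp.

Set Implicit Arguments.
Unset Strict Implicit.
Unset Printing Implicit Defensive.

(** * Critical tuples and essential predicates *)

Definition glue (A B T : Type) (f : A -> T) (g : B -> T) (z : A + B) : T :=
  match z with inl x => f x | inr y => g y end.

Definition rpred_of (k n : nat) (P : ('I_n -> 'I_k) -> Prop) : rpred k n :=
  [ffun t => `[<P (tnth t)>]].

(** Double counting: the sizes add up to the sum of the multiplicities of the points. These are all
    at least 1, so a single one above 1 would push the sum past [#|L|]. *)
Lemma cover_once (J L : finType) (A : J -> {set L}) :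
  \sum_j #|A j| <= #|L| -> (forall i, exists j, i \in A j) ->
  forall i, \sum_(j | i \in A j) 1 = 1.
Proof.
move=> cardA cover i.
have ge1 i' : 1 <= \sum_(j | i' \in A j) 1.
  by have [j Aj] := cover i'; rewrite (bigD1 j).
have sumE : \sum_j #|A j| = \sum_i' \sum_(j | i' \in A j) 1.
  rewrite (exchange_big_dep xpredT) //=; apply: eq_bigr => j _.
  by rewrite sum1_card.
apply/eqP; rewrite eqn_leq ge1 andbT leqNgt; apply/negP => gt1.
have : \sum_(i' : L) 1 < \sum_i' \sum_(j | i' \in A j) 1.
  by rewrite (bigD1 i) //= [ltnRHS](bigD1 i) //= -addSn leq_add // leq_sum.
by rewrite -sumE sum1_card ltnNge cardA.
Qed.

Lemma atom_holds_map (k : nat) (V V' : Type) (f : V -> V') (v : V' -> 'I_k)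
    (A : atom k V) :
  atom_holds v (Atom (map_tuple f (atom_vars A))) = atom_holds (v \o f) A.
Proof.
rewrite /atom_holds /=; congr (rel_of _ _); apply: val_inj => /=.
by rewrite -map_comp.
Qed.

(** In a decomposition, a conjunct that refutes [t] has smaller arity and so misses some coordinate
    [j]. It then refutes every change of [t] at [j] as well. *)
Lemma critical_essential (k n : nat) (r : rpred k n) (t : n.-tuple 'I_k) :
  ~~ r t ->
  (forall j, exists b, r [tuple if i == j then b else tnth t i | i < n]) ->
  essential (mkRk r).
Proof.
move=> rt relax [m [A [small holds]]].
have /forallPn[i nAi] : ~~ conj_holds A (tnth t) by rewrite -holds.
have [lt_i _] := small i.
have /existsP[j jNvars] : [exists j : 'I_n, j \notin tval (atom_vars (A i))].
  apply: contraTT lt_i => /existsPn all_in; rewrite -leqNgt /=.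
  rewrite -(size_tuple (atom_vars (A i))) -[leqLHS](card_ord n).
  apply: leq_trans (card_size _); apply/subset_leq_card/fintype.subsetP => j _.
  by have := all_in j; rewrite negbK.
have [b rb] := relax j; move/negP: nAi; apply.
have := holds [tuple if i == j then b else tnth t i | i < n].
rewrite [rel_of _ _]rb => /esym/forallP/(_ i).
rewrite /atom_holds; congr (is_true (rel_of _ _)); apply: val_inj => /=.
apply/eq_in_map => z zin; rewrite tnth_mktuple ifN //.
by apply: contraNneq jNvars => <-.
Qed.

(** The projections of [r] along each single coordinate always hold where [r] does. A tuple that
    satisfies all of them but not [r] is critical; if there is none, their conjunction is [r]. *)
Lemma essential_critical (k n : nat) (r : rpred k n.+1) :
  essential (mkRk r) ->
  exists2 t : n.+1.-tuple 'I_k, ~~ r t &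
    forall j, exists b, r [tuple if i == j then b else tnth t i | i < n.+1].
Proof.
move=> ess; apply: contrapT => no_crit; apply: ess.
pose proj (j : 'I_n.+1) : rpred k n :=
  [ffun z => [exists b, r [tuple if unlift j i is Some i' then tnth z i' else b
                          | i < n.+1]]].
pose A (j : 'I_n.+1) : atom k 'I_n.+1 :=
  @Atom k _ (mkRk (proj j)) [tuple lift j i | i < n].
exists n.+1, A; split.
  move=> j; split; first by rewrite /arity /= ltnS.
  by rewrite /= map_inj_uniq ?enum_uniq //; apply: lift_inj.
have AE (t : n.+1.-tuple 'I_k) j : atom_holds (tnth t) (A j) =
    [exists b, r [tuple if i == j then b else tnth t i | i < n.+1]].
  rewrite /atom_holds /= ffunE; apply: eq_existsb => b; congr (r _).
  apply: eq_from_tnth => i; rewrite !tnth_mktuple.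
  case: unliftP => [i'|] ->; last by rewrite eqxx.
  by rewrite tnth_map tnth_mktuple eq_sym (negbTE (neq_lift _ _)).
move=> t; rewrite /rel_of /=; apply/idP/forallP => [rt j|all_holds].
  rewrite AE; apply/existsP; exists (tnth t j); congr (is_true (r _)): rt.
  by apply: eq_from_tnth => i; rewrite tnth_mktuple; case: eqP => // ->.
apply: contrapT => /negP nrt; apply: no_crit; exists t => // j.
by have := all_holds j; rewrite AE => /existsP.
Qed.

(** * Primitive positive definability *)

Section PPDefinability.
Variables (k : nat) (G : Rk k -> Prop).

Definition basic (P : Rk k) : Prop := G P \/ P = rho_eq k \/ P = rho_false k.

(** Arbitrary types of free variables and finite types of bound variables and atoms avoid
    renumbering; [pp_closure_rpred_of] leads back to the numbered form of [pp_closure]. *)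
Definition pp (V : Type) (P : (V -> 'I_k) -> Prop) : Prop :=
  exists (W I : finType) (A : I -> atom k (V + W)),
    (forall i, basic (atom_pred (A i))) /\
    (forall v, P v <->
       exists w : W -> 'I_k, forall i, atom_holds (glue v w) (A i)).

Lemma pp_ext V (P P' : (V -> 'I_k) -> Prop) :
  pp P -> (forall v, P' v <-> P v) -> pp P'.
Proof.
case=> W [I [A [bA PE]]] P'E; exists W, I, A; split=> // v.
by rewrite P'E.
Qed.

Lemma pp_sub V V' (f : V -> V') (P : (V -> 'I_k) -> Prop) :
  pp P -> pp (fun v => P (v \o f)).
Proof.
case=> W [I [A [bA PE]]].
pose g (z : V + W) : V' + W := match z with inl x => inl (f x) | inr w => inr w end.
exists W, I, (fun i => Atom (map_tuple g (atom_vars (A i)))); split=> // v.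
rewrite PE; split=> -[w Hw]; exists w => i; have := Hw i; rewrite atom_holds_map;
  congr (is_true (atom_holds _ _)); by apply/funext=> -[].
Qed.

Lemma pp_ex V (U : finType) (P : (V + U -> 'I_k) -> Prop) :
  pp P -> pp (fun v => exists u, P (glue v u)).
Proof.
case=> W [I [A [bA PE]]].
pose g (z : (V + U) + W) : V + (U + W) :=
  match z with inl (inl x) => inl x | inl (inr u) => inr (inl u)
             | inr w => inr (inr w) end.
exists (U + W)%type, I, (fun i => Atom (map_tuple g (atom_vars (A i)))).
split=> // v; split=> [[u /PE[w Hw]]|[w Hw]].
  exists (glue u w) => i; rewrite atom_holds_map.
  by have := Hw i; congr (is_true (atom_holds _ _)); apply/funext => -[[]|].
exists (w \o inl); apply/PE; exists (w \o inr) => i.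
have := Hw i; rewrite atom_holds_map.
by congr (is_true (atom_holds _ _)); apply/funext => -[[]|].
Qed.

Lemma pp_exI V (U : finType) (P : (V -> 'I_k) -> Prop)
    (P' : (V + U -> 'I_k) -> Prop) :
  pp P' -> (forall v, P v <-> exists u, P' (glue v u)) -> pp P.
Proof. by move=> /pp_ex; apply: pp_ext. Qed.

Lemma pp_and V (P P' : (V -> 'I_k) -> Prop) :
  pp P -> pp P' -> pp (fun v => P v /\ P' v).
Proof.
case=> W [I [A [bA PE]]] [W' [I' [A' [bA' PE']]]].
pose g (z : V + W) : V + (W + W') :=
  match z with inl x => inl x | inr w => inr (inl w) end.
pose g' (z : V + W') : V + (W + W') :=
  match z with inl x => inl x | inr w => inr (inr w) end.
exists (W + W')%type, (I + I')%type, (fun i => match i with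
  | inl i => Atom (map_tuple g (atom_vars (A i)))
  | inr i => Atom (map_tuple g' (atom_vars (A' i))) end).
split=> [[]//|v]; rewrite PE PE'; split=> [[[w Hw] [w' Hw']]|[w Hw]].
  exists (glue w w') => -[i|i]; rewrite atom_holds_map.
    by have := Hw i; congr (is_true (atom_holds _ _)); apply/funext => -[].
  by have := Hw' i; congr (is_true (atom_holds _ _)); apply/funext => -[].
split.
  exists (w \o inl) => i; have := Hw (inl i); rewrite atom_holds_map.
  by congr (is_true (atom_holds _ _)); apply/funext => -[].
exists (w \o inr) => i; have := Hw (inr i); rewrite atom_holds_map.
by congr (is_true (atom_holds _ _)); apply/funext => -[].
Qed.

Lemma pp_true V : pp (fun _ : V -> 'I_k => True).
Proof.
exists void, void, (fun i : void => match i with end); split=> [[]|v].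
by split=> // _; exists (fun i : void => match i with end) => -[].
Qed.

Lemma pp_atom V (P : Rk k) (vars : (arity P).-tuple V) :
  basic P -> pp (fun v => rel_of P (map_tuple v vars)).
Proof.
move=> bP; exists void, unit, (fun=> Atom (map_tuple inl vars)); split=> // v.
have E w : atom_holds (glue v w) (Atom (map_tuple (@inl V void) vars)) =
    rel_of P (map_tuple v vars).
  by rewrite /atom_holds /=; congr (rel_of _ _); apply: val_inj;
     rewrite /= -map_comp.
split=> [Pv|[w /(_ tt)]]; last by rewrite E.
by exists (fun i : void => match i with end) => -[]; rewrite E.
Qed.

Lemma pp_eq V (x y : V) : pp (fun v => v x = v y).
Proof.
have bP : basic (rho_eq k) by right; left.
apply: pp_ext (@pp_atom V (rho_eq k) [tuple x; y] bP) _ => v.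
by rewrite /rel_of /= ffunE !(tnth_nth (v x)) /=; split=> [->|/eqP].
Qed.

Lemma pp_all_seq V (J : eqType) (s : seq J) (P : J -> (V -> 'I_k) -> Prop) :
  (forall j, j \in s -> pp (P j)) -> pp (fun v => forall j, j \in s -> P j v).
Proof.
elim: s => [|j s IHs] ppP; first by apply: (pp_ext (pp_true _)) => v; split.
have pps : pp (fun v => forall j, j \in s -> P j v).
  by apply: IHs => i si; apply: ppP; rewrite inE si orbT.
apply: (pp_ext (pp_and (ppP j (mem_head _ _)) pps)) => v.
split=> [Pv|[Pj Ps] i]; last by rewrite inE => /predU1P[->|/Ps].
by split=> [|i si]; apply: Pv; rewrite inE ?eqxx // si orbT.
Qed.

Lemma pp_all V (J : finType) (P : J -> (V -> 'I_k) -> Prop) :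
  (forall j, pp (P j)) -> pp (fun v => forall j, P j v).
Proof.
move=> ppP; apply: (pp_ext (@pp_all_seq _ _ (enum J) P _)) => // v.
by split=> [Pv j _ //|Pv j]; apply: Pv; rewrite mem_enum.
Qed.

Lemma pp_closure_rpred_of n (P : ('I_n -> 'I_k) -> Prop) :
  pp P -> pp_closure G (mkRk (rpred_of P)).
Proof.
case=> W [I [A [bA PE]]].
pose g (z : 'I_n + W) : 'I_n + 'I_#|W| :=
  match z with inl x => inl x | inr w => inr (enum_rank w) end.
exists #|W|, #|I|, (fun i => Atom (map_tuple g (atom_vars (A (enum_val i))))).
split.
  move=> i; case: (bA (enum_val i)) => [?|[?|?]]; first by left.
    by right; left.
  by right; right.
move=> x; rewrite /rel_of /= ffunE; apply/asboolP/existsP => [/PE[w Hw]|[y Hy]].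
  exists [tuple w (enum_val i) | i < #|W|]; apply/forallP => i.
  rewrite atom_holds_map; have := Hw (enum_val i).
  congr (is_true (atom_holds _ _)); apply/funext => -[]//= z.
  by rewrite tnth_mktuple enum_rankK.
apply/PE; exists (fun w => tnth y (enum_rank w)) => i.
move/forallP/(_ (enum_rank i)): Hy; rewrite atom_holds_map.
by rewrite enum_rankK; congr (is_true (atom_holds _ _)); apply/funext => -[].
Qed.

End PPDefinability.

(** * Predicates with leaves that can be switched on and off *)

Section Switches.
Variables (k : nat) (G : Rk k -> Prop).
Hypothesis const_G : forall a : 'I_k, G (rho_eq_const a).

Local Notation pp := (pp G).

Lemma pp_const (V : Type) (x : V) (c : 'I_k) : pp (fun v => v x = c).
Proof.
have bP : basic G (rho_eq_const c) by left.
apply: pp_ext (@pp_atom k G V (rho_eq_const c) [tuple x] bP) _ => v.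
by rewrite /rel_of /= ffunE /thead (tnth_nth (v x)) /=; split=> [->|/eqP].
Qed.

(** Every variable gets a bound copy, tied to its image by an equality or, if the image is a
    constant, by an atom [rho_eq_const]. *)
Lemma pp_subst (V : finType) (V' : Type) (f : V -> V' + 'I_k)
    (P : (V -> 'I_k) -> Prop) :
  pp P -> pp (fun v => P (fun x => match f x with inl y => v y | inr c => c end)).
Proof.
move=> ppP.
apply: (@pp_exI _ _ _ V _ (fun t => (forall x, t (inr x) =
    match f x with inl y => t (inl y) | inr c => c end) /\ P (t \o inr))).
  apply: pp_and (pp_sub _ ppP); apply: pp_all => x.
  by case: (f x) => [y|c]; [apply: pp_eq | apply: pp_const].
move=> v; split=> [Pv|[u [uE Pu]]]; first by eexists; split; last exact: Pv.
by congr P: Pu; apply/funext => x; rewrite -uE.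
Qed.

(* [R Y] is a predicate with leaves labelled in [Lb]: those with a label in [Y]
   are fixed to the values given by [a], the others are projected away. *)
Definition switched (Lb : finType) (a : Lb -> 'I_k) (Z : Type)
    (R : {set Lb} -> (Z -> 'I_k) -> Prop) : Prop :=
  exists (M : finType) (lab : M -> Lb) (P : (M + Z -> 'I_k) -> Prop),
    pp P /\ forall Y z, R Y z <->
      exists x : M -> 'I_k,
        (forall m, lab m \in Y -> x m = a (lab m)) /\ P (glue x z).

Lemma switched_ext (Lb : finType) (a : Lb -> 'I_k) (Z : Type)
    (R R' : {set Lb} -> (Z -> 'I_k) -> Prop) :
  switched a R -> (forall Y z, R' Y z <-> R Y z) -> switched a R'.
Proof.
case=> M [lab [P [ppP RE]]] R'E; exists M, lab, P; split=> // Y z.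
by rewrite R'E.
Qed.

Section OneLabelType.
Variables (Lb : finType) (a : Lb -> 'I_k).

Lemma switched_mono (Z : Type) (R : {set Lb} -> (Z -> 'I_k) -> Prop)
    (Y Y' : {set Lb}) z :
  switched a R -> Y' \subset Y -> R Y z -> R Y' z.
Proof.
case=> M [lab [P [_ RE]]] /fintype.subsetP subY /RE[x [xa Px]].
by apply/RE; exists x; split=> // m /subY/xa.
Qed.

Lemma switched_hard (Z : Type) (P : (Z -> 'I_k) -> Prop) :
  pp P -> switched a (fun=> P).
Proof.
move=> ppP; exists void, (@of_void Lb), (fun v => P (v \o inr)).
split; first exact: pp_sub ppP.
move=> Y z; split=> [Pz|[x []]//].
by exists (@of_void _); split=> // -[].
Qed.

Lemma switched_sub (Z Z' : Type) (f : Z -> Z')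
    (R : {set Lb} -> (Z -> 'I_k) -> Prop) :
  switched a R -> switched a (fun Y z => R Y (z \o f)).
Proof.
case=> M [lab [P [ppP RE]]].
pose g (y : M + Z) : M + Z' := match y with inl m => inl m | inr z => inr (f z) end.
exists M, lab, (fun v => P (v \o g)); split; first exact: pp_sub ppP.
have E x z : glue x z \o g = glue x (z \o f) by apply/funext=> -[].
by move=> Y z; rewrite RE; split=> -[x [xa Px]]; exists x; rewrite E in Px *.
Qed.

Lemma switched_and (Z : Type) (R R' : {set Lb} -> (Z -> 'I_k) -> Prop) :
  switched a R -> switched a R' -> switched a (fun Y z => R Y z /\ R' Y z).
Proof.
case=> M [lab [P [ppP RE]]] [M' [lab' [P' [ppP' RE']]]].
pose g (y : M + Z) : (M + M') + Z :=
  match y with inl m => inl (inl m) | inr z => inr z end.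
pose g' (y : M' + Z) : (M + M') + Z :=
  match y with inl m => inl (inr m) | inr z => inr z end.
exists (M + M')%type, (glue lab lab'), (fun v => P (v \o g) /\ P' (v \o g')).
split; first by apply: pp_and; exact: pp_sub.
have E x z : glue x z \o g = glue (x \o inl) z by apply/funext=> -[].
have E' x z : glue x z \o g' = glue (x \o inr) z by apply/funext=> -[].
move=> Y z; rewrite RE RE'; split.
  move=> [[x [xa Px]] [x' [xa' Px']]]; exists (glue x x').
  by rewrite E E'; split=> // -[m|m]; [apply: xa | apply: xa'].
move=> [x [xa]]; rewrite E E' => -[Px Px']; split.
  by exists (x \o inl); split=> // m /(xa (inl m)).
by exists (x \o inr); split=> // m /(xa (inr m)).
Qed.

Lemma switched_ex (Z : Type) (U : finType)
    (R : {set Lb} -> (Z -> 'I_k) -> Prop)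
    (R' : {set Lb} -> (Z + U -> 'I_k) -> Prop) :
  switched a R' -> (forall Y z, R Y z <-> exists u, R' Y (glue z u)) ->
  switched a R.
Proof.
case=> M [lab [P [ppP RE']]] RE.
pose g (y : M + (Z + U)) : (M + Z) + U :=
  match y with inl m => inl (inl m) | inr (inl z) => inl (inr z)
             | inr (inr u) => inr u end.
have E x z u : glue (glue x z) u \o g = glue x (glue z u).
  by apply/funext=> -[|[]].
exists M, lab, (fun v => exists u, P (glue v u \o g)).
split; first by apply: (pp_ex (P := fun t => P (t \o g))); exact: pp_sub ppP.
move=> Y z; rewrite RE; split=> [[u /RE'[x [xa Px]]]|[x [xa [u Pu]]]].
  by exists x; split=> //; exists u; rewrite E.
by exists u; apply/RE'; exists x; rewrite -E.
Qed.

Lemma switched_all (Z : Type) (J : finType)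
    (R : J -> {set Lb} -> (Z -> 'I_k) -> Prop) :
  (forall j, switched a (R j)) -> switched a (fun Y z => forall j, R j Y z).
Proof.
move=> swR.
suff sw_seq (s : seq J) : switched a (fun Y z => forall j, j \in s -> R j Y z).
  apply: switched_ext (sw_seq (enum J)) _ => Y z.
  by split=> [Rz j _ //|Rz j]; apply: Rz; rewrite mem_enum.
elim: s => [|j s IHs].
  by apply: (switched_ext (switched_hard (pp_true G Z))) => Y z; split.
apply: switched_ext (switched_and (swR j) IHs) _ => Y z.
split=> [Rz|[Rj Rs] i]; last by rewrite inE => /predU1P[->|/Rs].
by split=> [|i si]; apply: Rz; rewrite inE ?eqxx // si orbT.
Qed.

(** Leaves with a label outside [B] are released for good: they become bound variables, and only the
    others stay switchable. *)
Lemma switched_restr (Z : Type) (R : {set Lb} -> (Z -> 'I_k) -> Prop)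
    (B : {set Lb}) :
  switched a R -> switched a (fun Y => R (Y :&: B)).
Proof.
case=> M [lab [P [ppP RE]]].
pose M' := {m : M | lab m \in B}.
pose g (y : M + Z) : (M' + Z) + M :=
  match y with inl m => inr m | inr z => inl (inr z) end.
have E x z (v : M' + Z -> 'I_k) :
    (forall y, v (inr y) = z y) -> glue v x \o g = glue x z.
  by move=> vE; apply/funext=> -[//|y] /=; rewrite -vE.
exists M', (lab \o val), (fun v => exists x : M -> 'I_k,
    (forall m', x (val m') = v (inl m')) /\ P (glue v x \o g)).
split.
  apply: (pp_ex (P := fun t => (forall m' : M', t (inr (val m')) = t (inl (inl m')))
      /\ P (t \o g))).
  by apply: pp_and (pp_sub _ ppP); apply: pp_all => m'; exact: pp_eq.
move=> Y z; rewrite RE; split=> [[x [xa Px]]|[x' [xa' [x [xE Px]]]]].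
  exists (x \o val); split=> [m' Ym'|]; first by apply: xa; rewrite inE Ym' (valP m').
  by exists x; split=> //; rewrite (E x z).
exists x; rewrite (E x z) in Px => //; split=> // m.
rewrite inE => /andP[Ym Bm].
by have /= -> := xE (exist _ m Bm); apply: xa'.
Qed.

Lemma switched_fix (Z : Type) (R : {set Lb} -> (Z -> 'I_k) -> Prop) Y :
  switched a R -> pp (R Y).
Proof.
case=> M [lab [P [ppP RE]]].
pose g (y : M + Z) : Z + M := match y with inl m => inr m | inr z => inl z end.
apply: (pp_exI (P' := fun t => (forall m, lab m \in Y -> t (inr m) = a (lab m))
    /\ P (t \o g))).
  apply: pp_and (pp_sub _ ppP); apply: pp_all => m.
  case: (lab m \in Y); first by apply: pp_ext (pp_const _ _) _ => v; split; auto.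
  by apply: pp_ext (pp_true _ _) _ => v; split.
have E x z : glue z x \o g = glue x z by apply/funext=> -[].
by move=> z; rewrite RE; split=> -[x [xa Px]]; exists x; rewrite E in Px *.
Qed.

Lemma switched_leaf i :
  switched a (fun Y (z : unit -> 'I_k) => i \in Y -> z tt = a i).
Proof.
exists unit, (fun=> i), (fun v => v (inr tt) = v (inl tt)).
split=> [|Y z]; first exact: pp_eq.
split=> [zi|[x [xa /= ->]] Yi]; last exact: xa.
by exists z; split=> // -[].
Qed.

End OneLabelType.

Lemma switched_pull (Lb Lb' : finType) (a : Lb -> 'I_k) (a' : Lb' -> 'I_k)
    (f : Lb -> Lb') (Z : Type) (R : {set Lb} -> (Z -> 'I_k) -> Prop) :
  (forall l, a' (f l) = a l) ->
  switched a R -> switched a' (fun Y => R (f @^-1: Y)).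
Proof.
move=> af [M [lab [P [ppP RE]]]]; exists M, (f \o lab), P; split=> // Y z.
by rewrite RE; split=> -[x [xa Px]]; exists x; split=> // m;
  have := xa m; rewrite inE /= af.
Qed.

Variable p : nat.
Hypothesis max_p : forall P : Rk k, pp_closure G P -> essential P -> arity P <= p.

(** Take a minimal set [N] of leaves whose fixing is contradictory. With the leaves in [N] as
    arguments the predicate is refuted by the constants and accepted after a change of any one of
    them, hence essential, so that [N] has at most [p] elements. *)
Lemma switched_max (Lb : finType) (a : Lb -> 'I_k) (S : {set Lb} -> Prop) :
  switched a (fun Y (_ : void -> 'I_k) => S Y) -> ~ S [set: Lb] ->
  exists2 Y : {set Lb}, ~ S Y & #|Y| <= p.
Proof.
case=> M [lab [P [ppP SE]]] nS.
pose z0 : void -> 'I_k := @of_void _.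
pose Sat (N : {set M}) := exists x : M -> 'I_k,
  (forall m, m \in N -> x m = a (lab m)) /\ P (glue x z0).
have nSat : ~ Sat [set: M].
  move=> [x [xa Px]]; apply: nS; apply/(SE _ z0); exists x; split=> // m _.
  by apply: xa; rewrite inE.
have exN : exists N : {set M}, `[<~ Sat N>] by exists [set: M]; apply/asboolP.
have [N /minsetP[/asboolP nSatN minN]] := ex_minset exN.
have relax m : m \in N -> Sat (N :\ m).
  move=> Nm; apply: contrapT => /asboolP/minN/(_ (subD1set _ _))/setP/(_ m).
  by rewrite !inE eqxx Nm.
pose e (j : 'I_#|N|) : M := enum_val j.
have Ne j : e j \in N by apply: enum_valP.
pose R (v : 'I_#|N| -> 'I_k) := exists x : M -> 'I_k,
  (forall j, x (e j) = v j) /\ P (glue x z0).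
have ppR : pp R.
  pose g (y : M + void) : 'I_#|N| + M :=
    match y with inl m => inr m | inr z => match z with end end.
  have E v x : glue v x \o g = glue x z0 by apply/funext=> -[|[]].
  apply: (pp_exI (P' := fun t => (forall j, t (inr (e j)) = t (inl j))
      /\ P (t \o g))).
    by apply: pp_and (pp_sub _ ppP); apply: pp_all => j; exact: pp_eq.
  by move=> v; split=> -[x [xv Px]]; exists x; rewrite E in Px *.
have ess : essential (mkRk (rpred_of R)).
  apply: (@critical_essential _ _ _ [tuple a (lab (e j)) | j < #|N|]).
    rewrite ffunE; apply/asboolPn => -[x [xv Px]]; apply: nSatN.
    exists x; split=> // m Nm; have := xv (enum_rank_in Nm m).
    by rewrite tnth_mktuple /e enum_rankK_in.
  move=> j; have [x [xa Px]] := relax _ (Ne j); exists (x (e j)).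
  rewrite ffunE; apply/asboolP; exists x; split=> // i; rewrite !tnth_mktuple.
  have [-> //|neq_ij] := eqVneq i j; apply: xa; rewrite !inE Ne andbT.
  by apply: contra_neq neq_ij => /enum_val_inj.
exists (lab @: N); last first.
  apply: leq_trans (leq_imset_card _ _) _.
  exact: (max_p (pp_closure_rpred_of ppR) ess).
move=> /(SE _ z0)[x [xa Px]]; apply: nSatN; exists x; split=> // m Nm.
exact/xa/imset_f.
Qed.

(** With labels in [J * Lb] every member of the family has its own copy of each leaf, so the bound
    [p] applies to all copies together. *)
Lemma switched_family_max (Lb : finType) (a : Lb -> 'I_k) (J Z : finType)
    (H : (Z -> 'I_k) -> Prop) (R : J -> {set Lb} -> (Z -> 'I_k) -> Prop) :
  pp H -> (forall j, switched a (R j)) ->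
  ~ (exists2 z, H z & forall j, R j [set: Lb] z) ->
  exists2 A : J -> {set Lb}, \sum_j #|A j| <= p &
    ~ exists2 z, H z & forall j, R j (A j) z.
Proof.
move=> ppH swR unsat.
pose S (Y : {set J * Lb}) :=
  exists2 z, H z & forall j, R j (pair j @^-1: Y) z.
have [||Y nSY cardY] := @switched_max _ (fun l : J * Lb => a l.2) S.
- pose R' (Y : {set J * Lb}) (t : void + Z -> 'I_k) :=
    H (t \o inr) /\ forall j, R j (pair j @^-1: Y) (t \o inr).
  apply: (@switched_ex _ _ _ Z _ R').
    apply: switched_and.
      by apply: (@switched_hard _ _ _ (fun t => H (t \o inr))); apply: pp_sub.
    apply: switched_all => j.
    apply: (switched_pull (R := fun X t => R j X (t \o inr)) _ _) => //.
    exact: switched_sub.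
  by move=> Y z; split=> [[u Hu Ru]|[u [Hu Ru]]]; exists u.
- move=> [z Hz Rz]; apply: unsat; exists z => // j; have := Rz j.
  by congr (R j _ z); apply/setP => l; rewrite !inE.
exists (fun j => pair j @^-1: Y) => //; apply: leq_trans cardY.
rewrite -sum1_card (eq_bigr (fun j => \sum_(l | (j, l) \in Y) 1)) => [|j _].
  by rewrite pair_big_dep /= leq_eqVlt; apply/orP; left; apply/eqP/eq_bigl => -[].
by rewrite -sum1_card; apply: eq_bigl => l; rewrite inE.
Qed.

End Switches.

(** * Cutting a loop *)

Section Cutting.
Variables (k : nat) (G : Rk k -> Prop).
Hypothesis const_G : forall a : 'I_k, G (rho_eq_const a).
Variables (L : finType) (a : L -> 'I_k).
Hypothesis max_p :
  forall P : Rk k, pp_closure G P -> essential P -> arity P <= #|L|.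
(** [B Y] is the edge relation of the digraph left when one equality of the formula is dropped, with
    exactly the leaves in [Y] switched on. *)
Variable B : {set L} -> 'I_k -> 'I_k -> Prop.
Hypothesis sw_B :
  switched G a (fun Y (z : bool -> 'I_k) => B Y (z false) (z true)).

Local Notation pp := (pp G).
Local Notation pp1 C := (pp (fun v : unit -> 'I_k => v tt \in C)).

(** Each edge carries its own copy of all leaves, yet by maximality a refutation needs at most
    [#|L|] active leaves over all edges together. *)
Lemma path_max n (C : nat -> {set 'I_k}) :
  (forall j, pp1 (C j)) ->
  ~ (exists2 w : nat -> 'I_k, forall j, j <= n -> w j \in C j
       & forall j, j < n -> B [set: L] (w j) (w j.+1)) ->
  exists2 A : 'I_n -> {set L}, \sum_j #|A j| <= #|L| &
    ~ exists2 w : nat -> 'I_k, forall j, j <= n -> w j \in C j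
       & forall j : 'I_n, B (A j) (w j) (w j.+1).
Proof.
move=> ppC unsat.
pose H (z : 'I_n.+1 -> 'I_k) := forall j : 'I_n.+1, z j \in C j.
pose R (j : 'I_n) Y (z : 'I_n.+1 -> 'I_k) := B Y (z (inord j)) (z (inord j.+1)).
have ppH : pp H by apply: pp_all => j; exact: (pp_sub (fun=> j) (ppC j)).
have swR j : switched G a (R j).
  exact: (switched_sub (fun b : bool => inord (if b then j.+1 else j)) sw_B).
have [[z Hz Rz]|A cardA nA] := switched_family_max max_p ppH swR.
  apply: unsat; exists (fun j => z (inord j)) => j lt_jn.
    by have := Hz (inord j); rewrite inordK.
  exact: (Rz (Ordinal lt_jn)).
exists A => // -[w wC wB]; apply: nA; exists (fun j : 'I_n.+1 => w j) => j.
  by apply: wC; rewrite -ltnS.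
by rewrite /R !inordK // ltnS // ltnW.
Qed.

Definition walk n (C : {set 'I_k}) (w : nat -> 'I_k) :=
  (forall j, j <= n -> w j \in C) /\
  (forall j, j < n -> B [set: L] (w j) (w j.+1)).

Definition step (C Q : {set 'I_k}) : {set 'I_k} :=
  [set y in C | `[<exists2 x, x \in Q & B [set: L] x y>]].

Lemma step_sub C Q : step C Q \subset C.
Proof. by apply/fintype.subsetP => y; rewrite inE => /andP[]. Qed.

Lemma iter_stepP (C : {set 'I_k}) c n y : c \in C ->
  reflect (exists w, [/\ walk n C w, w 0 = c & w n = y])
          (y \in iter n (step C) [set c]).
Proof.
move=> Cc; apply: (iffP idP); elim: n y => [|n IHn] y /=.
- by rewrite inE => /eqP->; exists (fun=> c).
- rewrite inE => /andP[Cy /asboolP[x /IHn[w [[wC wB] w0 wn]] Bxy]].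
  exists (fun j => if j <= n then w j else y); split=> //; last by rewrite ltnn.
  split=> j le_jn; first by case: ifP => // /wC.
  rewrite ltnS in le_jn; rewrite le_jn; case: (ltnP j n) => [/wB //|le_nj].
  have -> : j = n by apply/eqP; rewrite eqn_leq le_jn.
  by rewrite wn.
- by move=> [w [_ -> ->]]; rewrite inE.
- move=> [w [[wC wB] w0 wn]]; rewrite inE -wn wC //=; apply/asboolP.
  exists (w n); last exact: wB.
  apply: IHn; exists w; split=> //; split=> j le_jn; first by rewrite wC ?leqW.
  by apply: wB; apply: leqW.
Qed.

Lemma pp1_step (C Q : {set 'I_k}) : pp1 C -> pp1 Q -> pp1 (step C Q).
Proof.
move=> ppC ppQ; apply: (@pp_exI _ _ unit unit _ (fun t => t (inl tt) \in C /\
  (t (inr tt) \in Q /\ B [set: L] (t (inr tt)) (t (inl tt))))).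
  apply: pp_and; first exact: (pp_sub inl ppC).
  apply: pp_and; first exact: (pp_sub inr ppQ).
  have := pp_sub (fun b : bool => if b then inl tt else inr tt : unit + unit)
    (switched_fix const_G [set: L] sw_B).
  by [].
move=> v; rewrite inE; split=> [/andP[Cv /asboolP[x Qx Bx]]|[u [Cv [Qu Bu]]]].
  by exists (fun=> x).
by apply/andP; split=> //; apply/asboolP; exists (u tt).
Qed.

Lemma pp1_iter_step (C : {set 'I_k}) c n : pp1 C -> pp1 (iter n (step C) [set c]).
Proof.
move=> ppC; elim: n => [|n IHn]; last exact: pp1_step.
apply: (pp_ext (pp_const const_G tt c)) => v.
by rewrite inE; split=> /eqP.
Qed.

(* A walk of length n can be lengthened by a loop at any of its vertices as
   soon as one edge carries no active leaf; if no walk of length n.+1 has the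
   same ends, all n.+1 edges need an active leaf. *)
Lemma iter_step_incr (C : {set 'I_k}) c n :
  pp1 C -> (forall x, x \in C -> B set0 x x) -> c \in C -> #|L| <= n ->
  iter n (step C) [set c] \subset iter n.+1 (step C) [set c].
Proof.
move=> ppC loopC Cc le_Ln; apply/fintype.subsetP => y.
move=> /(iter_stepP _ _ Cc)[w [[wC wB] w0 wn]].
apply/(iter_stepP _ _ Cc); apply: contrapT => nwalk.
have Cy : y \in C by rewrite -wn wC.
(* Both ends are pinned, so that a solution would be the walk of length [n.+1] assumed not to
   exist. *)
pose D j : {set 'I_k} := if j == 0 then [set c] else if j == n.+1 then [set y] else C.
have ppD j : pp1 (D j).
  have ppset1 x : pp1 [set x].
    by apply: (pp_ext (pp_const const_G tt x)) => v; rewrite inE; split=> /eqP.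
  by rewrite /D; do 2?case: ifP.
have [|A cardA nA] := @path_max n.+1 D ppD.
  move=> [v vD vB]; apply: nwalk; exists v; split.
  - split=> // j /vD; rewrite /D; case: ifP => _; first by rewrite inE => /eqP->.
    by case: ifP => // _; rewrite inE => /eqP->.
  - by have := vD 0 isT; rewrite inE => /eqP.
  - by have := vD n.+1 (leqnn _); rewrite /D eqxx inE => /eqP.
have [t At0] : exists t, A t = set0.
  apply: contrapT => noA; have : \sum_(j < n.+1) 1 <= \sum_j #|A j|.
    apply: leq_sum => j _; rewrite card_gt0; apply/eqP => Aj0.
    by apply: noA; exists j.
  by rewrite sum1_card card_ord leqNgt ltnS (leq_trans cardA).
apply: nA; exists (fun j => if j <= t then w j else w j.-1) => j.
  move=> le_jn; rewrite /D.
  have [->|j_gt0] := posnP j; first by rewrite leq0n w0 inE.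
  have [->|neq_jn] := eqVneq j n.+1.
    by rewrite leqNgt ltn_ord /= wn inE.
  have lt_jn : j <= n by rewrite -ltnS ltn_neqAle neq_jn.
  by case: ifP => _; apply: wC => //; apply: leq_trans (leq_pred j) lt_jn.
have [lt_jt|lt_tj|/val_inj->] := ltngtP j t.
- apply: (switched_mono (Y := [set: L]) (z := fun b => if b then w j.+1 else w j) sw_B).
    exact: subsetT.
  by apply: wB; apply: leq_trans lt_jt _; rewrite -ltnS.
- have := wB j.-1; rewrite prednK ?(leq_trans _ lt_tj) // -ltnS ltn_ord => /(_ isT) Bw.
  exact: (switched_mono (Y := [set: L]) (z := fun b => if b then w j else w j.-1) sw_B).
by rewrite At0 /=; apply/loopC/wC; rewrite -ltnS.
Qed.

Lemma walk_of_pred (Q : {set 'I_k}) y0 :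
  y0 \in Q -> (forall y, y \in Q -> exists2 x, x \in Q & B [set: L] x y) ->
  forall n, exists w, walk n Q w.
Proof.
move=> Qy0 predQ; elim=> [|n [w [wQ wB]]]; first by exists (fun=> y0).
have [x Qx Bx] := predQ _ (wQ 0 isT).
exists (fun j => if j is j'.+1 then w j' else x).
by split; [case=> [|j] //= /wQ | case=> [|j] //= /wB].
Qed.

(** Induction on the size of [C]: unbounded walks would yield either a loop or a smaller definable
    set in which every vertex has a predecessor, and hence again unbounded walks. *)
Lemma bounded_walks (C : {set 'I_k}) :
  (forall c, ~ B [set: L] c c) -> pp1 C -> (forall c, c \in C -> B set0 c c) ->
  exists n, forall w, ~ walk n C w.
Proof.
move=> noloop; have [m] := ubnP #|C|; elim: m C => // m IHm C leCm ppC loopC.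
have small (Q : {set 'I_k}) y0 : Q \subset C -> Q != C -> pp1 Q -> y0 \in Q ->
    (forall y, y \in Q -> exists2 x, x \in Q & B [set: L] x y) -> False.
  move=> subQ neqQ ppQ Qy0 predQ.
  have [|c Qc|n nwalk] := IHm Q _ ppQ.
  - rewrite ltnS in leCm; apply: leq_trans (proper_card _) leCm.
    by rewrite properEneq neqQ.
  - exact/loopC/(fintype.subsetP subQ).
  by have [w] := walk_of_pred Qy0 predQ n; exact: nwalk.
apply: contrapT => nbound.
have long n : exists w, walk n C w.
  by apply: contrapT => nw; apply: nbound; exists n => w Cw; apply: nw; exists w.
(* If the walks from each [c] were bounded, the maximum of the finitely many bounds would bound all
   walks. *)
have [c [Cc ntQ]] : exists c, c \in C /\ forall n, iter n (step C) [set c] != set0.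
  apply: contrapT => noc.
  have bnd c : exists n, c \in C -> iter n (step C) [set c] = set0.
    case: (boolP (c \in C)) => [Cc|_]; last by exists 0.
    apply: contrapT => ntc; apply: noc; exists c; split=> // n.
    by apply/eqP => Qn0; apply: ntc; exists n.
  have [N QN0] := choice bnd; have [w [wC wB]] := long (\max_c N c).
  have leN : N (w 0) <= \max_c N c by apply: leq_bigmax.
  have := QN0 (w 0) (wC 0 isT) => /setP/(_ (w (N (w 0)))).
  rewrite inE => /negP; apply; apply/iter_stepP; first exact: wC.
  exists w; split=> //; split=> j lt_j; first exact/wC/(leq_trans lt_j).
  exact/wB/(leq_trans lt_j).
pose Q n := iter n (step C) [set c].
(* From [#|L|] steps on the reachable sets increase, so they become stationary within [E_k]. *)
have [n Qstep] : exists n, step C (Q n) = Q n.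
  apply: contrapT => noeq.
  have incr j : j <= #|Q (#|L| + j)|.
    elim: j => // j IHj; rewrite addnS; apply: leq_ltn_trans IHj _.
    apply: proper_card; rewrite properEneq iter_step_incr ?leq_addr // andbT.
    by apply/eqP => eqQ; apply: noeq; exists (#|L| + j).
  have := leq_trans (incr k.+1) (max_card _).
  by rewrite card_ord ltnn.
have [QnC|neqQC] := eqVneq (Q n) C; last first.
  have /set0Pn[y0 Qy0] := ntQ n.
  apply: (@small (Q n) y0) => //; first by rewrite -Qstep step_sub.
    exact: pp1_iter_step.
  by move=> y; rewrite -{1}Qstep inE => /andP[_ /asboolP].
(* The reachable set is all of [C]. At the first time this happens, either [C] is the single vertex
   [c], which then has a loop, or the set one step earlier is proper and contains a predecessor of
   each vertex of [C]. *)
have exQ : exists n, Q n == C by exists n; apply/eqP.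
case: (ex_minnP exQ) => -[|N] /eqP QNC minN.
  have : c \in step C (Q n) by rewrite Qstep QnC.
  rewrite inE QnC -QNC => /andP[_ /asboolP[x]].
  by rewrite inE => /eqP-> /noloop.
have neqQN : Q N != C by apply/negP => /minN; rewrite ltnn.
have /set0Pn[y0 Qy0] := ntQ N.
have subQN : Q N \subset C by case: (N) => [|N']; rewrite ?step_sub // sub1set.
apply: (@small (Q N) y0) => //; first exact: pp1_iter_step.
by move=> y /(fintype.subsetP subQN); rewrite -{1}QNC inE => /andP[_ /asboolP].
Qed.

(* Unfolds the loop into a walk through n copies of B. Since no essential
   predicate has more than #|L| arguments, the active leaves of a minimal
   refutation of that walk are spread over the copies without repetition. *)
Lemma cut_edge :
  (forall c, ~ B [set: L] c c) -> (forall i, exists c, B [set~ i] c c) ->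
  exists n (A : nat -> {set L}),
    (forall i j j', i \in A j -> i \in A j' -> j = j') /\
    ~ (exists2 w : nat -> 'I_k, forall j, j <= n -> B set0 (w j) (w j)
         & forall j, j < n -> B (A j) (w j) (w j.+1)).
Proof.
move=> noloop loop; pose D := [set c | `[<B set0 c c>]].
have ppD : pp1 D.
  apply: (pp_ext (pp_sub (fun=> tt) (switched_fix const_G set0 sw_B))) => v.
  by rewrite inE; split=> /asboolP.
have [c|n nwalk] := @bounded_walks D noloop ppD; first by rewrite inE => /asboolP.
have [[w wD wB]|A cardA nA] := @path_max n (fun=> D) (fun=> ppD).
  by apply: (nwalk w).
(* If leaf [i] were active nowhere, the constant walk at a loop of [B [set~ i]] would solve the
   unfolding. So every leaf is used, and by counting it is used once. *)
have cover i : exists j, i \in A j.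
  apply: contrapT => noj; have [c Bc] := loop i; apply: nA; exists (fun=> c).
    move=> _ _; rewrite inE; apply/asboolP.
    by apply: (switched_mono (z := fun=> c) sw_B _ Bc); apply: sub0set.
  move=> j; apply: (switched_mono (z := fun=> c) sw_B _ Bc).
  apply/fintype.subsetP => i' Ai'; rewrite !inE; apply: contra_notN noj.
  by move=> /eqP<-; exists j.
have once := cover_once cardA cover.
exists n, (fun j => if insub j is Some j' then A j' else set0); split.
  move=> i j j'; case: insubP => [t _ <-|_]; last by rewrite inE.
  case: insubP => [t' _ <-|_]; last by rewrite inE.
  move=> Aj Aj'; apply: contrapT => neq_j; have := once i; rewrite (bigD1 t) //= (bigD1 t') //=.
  by rewrite Aj' /=; apply/eqP => /esym eq_j; apply: neq_j; rewrite eq_j.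
move=> [w wD wB]; apply: nA; exists w.
  by move=> j le_jn; rewrite inE; apply/asboolP/wD.
by move=> j; have := wB j (ltn_ord j); rewrite valK.
Qed.

End Cutting.

(** * Acyclic formulas *)

(* Acyclic formulas rooted at a variable y; [Node R j ch] stands for
   R(v_0, .., v_{m-1}) with y = v_j and subformulas ch i rooted at v_i, and
   [Leaf w B] for the predicate named w with the leaves in B switched on. *)
Inductive tree (k : nat) (L : finType) (W : Type) : Type :=
  | Top
  | Leaf of W & {set L}
  | And of tree k L W & tree k L W
  | Node m of (('I_m -> 'I_k) -> Prop) & 'I_m & ('I_m -> tree k L W).

Arguments Top {k L W}.

Section Trees.
Variables (k : nat) (G : Rk k -> Prop) (L : finType) (a : L -> 'I_k) (Q : nat).

Local Notation tree := (tree k L).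
Local Notation K := 'I_k.

Fixpoint eval W (ev : W -> {set L} -> K -> Prop) (t : tree W) (y : K) : Prop :=
  match t with
  | Top => True
  | Leaf w B => ev w B y
  | And s t => eval ev s y /\ eval ev t y
  | Node m R j ch =>
      exists v : 'I_m -> K, [/\ v j = y, R v & forall i, eval ev (ch i) (v i)]
  end.

(** The bound [Q] on the arity of nodes limits the branching in [extract_chain]. *)
Fixpoint hard W (t : tree W) : Prop :=
  match t with
  | Top | Leaf _ _ => True
  | And s t => hard s /\ hard t
  | Node m R _ ch => [/\ m <= Q, pp G R & forall i, hard (ch i)]
  end.

(** With [wt] constantly 1 this is the number of occurrences of the leaf [x]; another choice of [wt]
    is the termination measure in [resolve]. *)
Fixpoint weight W (wt : W -> nat) (t : tree W) (x : L) : nat :=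
  match t with
  | Top => 0
  | Leaf w B => (x \in B) * wt w
  | And s t => weight wt s x + weight wt t x
  | Node m _ _ ch => \sum_(i < m) weight wt (ch i) x
  end.

Fixpoint restr W (B : {set L}) (t : tree W) : tree W :=
  match t with
  | Top => Top
  | Leaf w A => Leaf k w (A :&: B)
  | And s t => And (restr B s) (restr B t)
  | Node m R j ch => Node R j (fun i => restr B (ch i))
  end.

Fixpoint subst W W' (s : W -> tree W') (t : tree W) : tree W' :=
  match t with
  | Top => Top
  | Leaf w B => restr B (s w)
  | And t t' => And (subst s t) (subst s t')
  | Node m R j ch => Node R j (fun i => subst s (ch i))
  end.

Lemma eval_mono W (ev ev' : W -> {set L} -> K -> Prop) t y :
  (forall w B z, ev w B z -> ev' w B z) -> eval ev t y -> eval ev' t y.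
Proof.
move=> sub; elim: t y => [|w B|s IHs t IHt|m R j ch IHch] y //=; first exact: sub.
- by move=> [/IHs ? /IHt ?].
- by move=> [v [vj Rv chv]]; exists v; split=> // i; apply: IHch.
Qed.

Lemma eval_ext W (ev ev' : W -> {set L} -> K -> Prop) t y :
  (forall w B z, ev w B z <-> ev' w B z) -> eval ev t y <-> eval ev' t y.
Proof. by move=> E; split; apply: eval_mono => w B z /E. Qed.

Lemma eval_restr W (ev : W -> {set L} -> K -> Prop) B t y :
  eval ev (restr B t) y <-> eval (fun w A => ev w (A :&: B)) t y.
Proof.
elim: t y => [|w A|s IHs t IHt|m R j ch IHch] y //=; first by rewrite IHs IHt.
by split=> -[v [vj Rv chv]]; exists v; split=> // i; apply/IHch.
Qed.

Lemma eval_subst W W' (ev : W' -> {set L} -> K -> Prop) (s : W -> tree W') t y :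
  eval ev (subst s t) y <-> eval (fun w B => eval ev (restr B (s w))) t y.
Proof.
elim: t y => [|w A|t IHt t' IHt'|m R j ch IHch] y //=; first by rewrite IHt IHt'.
by split=> -[v [vj Rv chv]]; exists v; split=> // i; apply/IHch.
Qed.

Lemma hard_restr W B (t : tree W) : hard t -> hard (restr B t).
Proof.
elim: t => [|w A|s IHs t IHt|m R j ch IHch] //=; first by case=> /IHs ? /IHt.
by case=> leQ ppR hch; split=> // i; apply: IHch.
Qed.

Lemma hard_subst W W' (s : W -> tree W') t :
  (forall w, hard (s w)) -> hard t -> hard (subst s t).
Proof.
move=> hs; elim: t => [|w A|t IHt t' IHt'|m R j ch IHch] //=.
- by move=> _; exact: hard_restr.
- by case=> /IHt ? /IHt'.
- by case=> leQ ppR hch; split=> // i; apply: IHch.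
Qed.

Lemma weight_restr W (wt : W -> nat) B t x :
  weight wt (restr B t) x = (x \in B) * weight wt t x.
Proof.
elim: t => [|w A|s IHs t IHt|m R j ch IHch] /=; rewrite ?muln0 //.
- by rewrite inE mulnA mulnb andbC.
- by rewrite IHs IHt mulnDr.
- by rewrite big_distrr /=; apply: eq_bigr => i _; apply: IHch.
Qed.

Lemma weight_subst W W' (wt : W' -> nat) (s : W -> tree W') t x c :
  (forall w, weight wt (s w) x <= c) ->
  weight wt (subst s t) x <= weight (fun=> 1) t x * c.
Proof.
move=> le_c; elim: t => [|w A|t IHt t' IHt'|m R j ch IHch] //=.
- by rewrite weight_restr muln1 leq_mul2l le_c orbT.
- by rewrite mulnDl leq_add.
- by rewrite big_distrl leq_sum.
Qed.

Definition switch W (lam : W -> {set L} -> K -> Prop) (X : {set L})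
  (w : W) (B : {set L}) (y : K) : Prop := lam w (X :&: B) y.

Lemma eval_switch_subst W W' (lam : W' -> {set L} -> K -> Prop)
    (s : W -> tree W') X t y :
  eval (switch lam X) (subst s t) y <->
  eval (switch (fun w Y => eval (switch lam Y) (s w)) X) t y.
Proof.
rewrite eval_subst; apply: eval_ext => w B z; rewrite eval_restr.
by apply: eval_ext => w' A u; rewrite /switch setIA setIAC.
Qed.

Local Notation switched1 R :=
  (switched G a (fun Y (z : unit -> K) => R Y (z tt))).

Lemma switched_eval W (lam : W -> {set L} -> K -> Prop) t :
  (forall w, switched1 (lam w)) -> hard t ->
  switched1 (fun X => eval (switch lam X) t).
Proof.
move=> swl; elim: t => [|w A|s IHs t IHt|m R j ch IHch] /=.
- by move=> _; apply: (@switched_hard _ _ _ _ _ (fun=> True)); apply: pp_true.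
- by move=> _; apply: (switched_restr A (swl w)).
- by move=> [/IHs ? /IHt ?]; apply: switched_and.
move=> [_ ppR hch].
apply: (@switched_ex _ _ _ _ _ 'I_m _ (fun X (z : unit + 'I_m -> K) =>
  z (inr j) = z (inl tt) /\ (R (z \o inr) /\
  forall i, eval (switch lam X) (ch i) (z (inr i))))).
  apply: switched_and.
    by apply: (@switched_hard _ _ _ _ _ (fun z => z (inr j) = z (inl tt))); apply: pp_eq.
  apply: switched_and.
    by apply: (@switched_hard _ _ _ _ _ (fun z => R (z \o inr))); apply: pp_sub.
  apply: switched_all => i.
  exact: (switched_sub (fun=> inr i) (IHch i (hch i))).
by move=> X z; split=> [[v [? ? ?]]|[v [? [? ?]]]]; exists v.
Qed.

(* The path from the root to the chosen leaf is turned upside down, everything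
   hanging off it (and [o], hanging off the root) being collected in [u]. *)
Lemma reroot W (wt : W -> nat) x0 (t o : tree W) :
  hard t -> hard o -> 0 < weight wt t x0 ->
  exists w (B : {set L}) u, [/\ x0 \in B /\ 0 < wt w, hard u,
    forall wt' x, weight wt' t x + weight wt' o x =
                  (x \in B) * wt' w + weight wt' u x
  & forall ev : W -> {set L} -> K -> Prop,
      (exists2 y, eval ev t y & eval ev o y) <->
      (exists2 y, ev w B y & eval ev u y)].
Proof.
elim: t o => [|w A|s IHs t IHt|m R j ch IHch] o //=.
- rewrite muln_gt0 lt0b => _ ho /andP[Ax0 wt0].
  by exists w, A, o; split.
- move=> [hs ht] ho; rewrite addn_gt0 => /orP[] pos.
    have [w [B [u [? ? wE uE]]]] := IHs (And t o) hs (conj ht ho) pos.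
    exists w, B, u; split=> // [wt' x|ev]; first by rewrite -wE /= addnA.
    by rewrite -uE /=; split=> [[y []]|[y ? []]] *; exists y.
  have [w [B [u [? ? wE uE]]]] := IHt (And s o) ht (conj hs ho) pos.
  exists w, B, u; split=> // [wt' x|ev]; first by rewrite -wE /= addnCA addnA.
  by rewrite -uE /=; split=> [[y []]|[y ? []]] *; exists y.
move=> [leQ ppR hch] ho.
have [i pos _|all0] := pickP (fun i => 0 < weight wt (ch i) x0); last first.
  by rewrite big1 // => i _; apply/eqP; rewrite -leqn0 leqNgt all0.
(* The node is turned so that child [i] becomes its root; the subtree of [i] is taken out and [o] is
   hung at the old root [j]. *)
pose o' := Node R i (fun i' => And (if i' == i then Top else ch i')
                                   (if i' == j then o else Top)).
have ho' : hard o' by split=> // i'; split; case: ifP.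
have [w [B [u [? ? wE uE]]]] := IHch i o' (hch i) ho' pos.
exists w, B, u; split=> // [wt' x|ev].
  rewrite -wE /= big_split /= (bigD1 i) //= -!addnA; congr (_ + _).
  congr (_ + _); last by rewrite (bigD1 j) //= eqxx big1 ?addn0 // => i' /negbTE->.
  rewrite [RHS](bigD1 i) //= eqxx /= add0n.
  by apply: eq_bigr => i' /negbTE->.
rewrite -uE; split=> [[_ [v [<- Rv chv]] ov]|[y chi [v [vi Rv ov]]]].
  exists (v i) => //; exists v; split=> // i'; split; first by case: ifP.
  by case: eqP => // ->.
exists (v j); last by have [_] := ov j; rewrite eqxx.
exists v; split=> // i'.
by have [->|neq] := eqVneq i' i; [rewrite vi | have [] := ov i'; rewrite (negbTE neq)].
Qed.

End Trees.

(** * Making a formula acyclic *)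

(* Ends of the walks with j edges, the i-th of which carries the leaves A i. *)
Fixpoint walk_end (k : nat) (L : finType) (F : {set L} -> 'I_k -> 'I_k -> Prop)
    (A : nat -> {set L}) (j : nat) (X : {set L}) (y : 'I_k) : Prop :=
  if j is j'.+1 then
    F set0 y y /\ exists2 z, walk_end F A j' X z & F (X :&: A j') z y
  else F set0 y y.

Section Acyclic.
Variables (k : nat) (G : Rk k -> Prop).
Hypothesis const_G : forall a : 'I_k, G (rho_eq_const a).
Variables (L : finType) (a : L -> 'I_k) (Q : nat).
Hypothesis L_gt0 : 0 < #|L|.
Hypothesis Q_gt0 : 0 < Q.
Hypothesis max_p :
  forall P : Rk k, pp_closure G P -> essential P -> arity P <= #|L|.

Local Notation tree := (tree k L).
Local Notation K := 'I_k.
Local Notation switched1 R :=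
  (switched G a (fun Y (z : unit -> K) => R Y (z tt))).

Section Formula.
Variables (I : finType) (ar : I -> nat).
Variable (R : forall i, ('I_(ar i) -> K) -> Prop).
Hypothesis pp_R : forall i, pp G (@R i).
Hypothesis ar_Q : forall i, ar i <= Q.

Local Notation V := {i : I & 'I_(ar i)}.
Local Notation node i j := (existT (fun i => 'I_(ar i)) i j).

(* Every variable occurs once in the atoms, all identifications of variables
   being listed in [E]. *)
Definition formula (E : seq (V * V)) (o : V -> K) : Prop :=
  (forall i, R (fun j => o (node i j))) /\ (forall e, e \in E -> o e.1 = o e.2).

Lemma pp_formula E : pp G (formula E).
Proof.
apply: pp_and.
  by apply: pp_all => i; exact: (pp_sub (fun j => node i j) (pp_R i)).
apply: (@pp_all_seq _ _ _ _ E (fun e (o : V -> K) => o e.1 = o e.2)) => e _.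
exact: pp_eq.
Qed.

(** The acyclic counterpart of a critical formula: no leaf is repeated and a refutation needs them
    all. *)
Definition resolved W (lam : W -> {set L} -> K -> Prop) (t : tree W) : Prop :=
  [/\ hard G Q t, forall x, weight (fun=> 1) t x <= 1,
      ~ (exists y, eval (switch lam [set: L]) t y)
    & forall x, exists y, eval (switch lam [set~ x]) t y].

(** Without equalities the atoms share no variables, so a refutation lives in a single atom, which
    becomes a tree of depth one. By maximality each leaf is active at exactly one variable. *)
Lemma resolve0 (lam : V -> {set L} -> K -> Prop) :
  (forall w, switched1 (lam w)) ->
  ~ (exists2 o, formula [::] o & forall w, lam w [set: L] (o w)) ->
  (forall x, exists2 o, formula [::] o & forall w, lam w [set~ x] (o w)) ->
  exists t, resolved lam t.
Proof.
move=> swl unsat sat.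
have swR w : switched G a (fun Y (o : V -> K) => lam w Y (o w)).
  exact: (switched_sub (fun=> w) (swl w)).
have lam_mono w (X X' : {set L}) y : X \subset X' -> lam w X' y -> lam w X y.
  by move=> sub; apply: (switched_mono (z := fun=> y) (swl w)).
have [A cardA unsatA] := switched_family_max max_p (pp_formula [::]) swR unsat.
have cover x : exists w, x \in A w.
  apply: contrapT => nox; have [o Fo lamo] := sat x; apply: unsatA; exists o => // w.
  apply: lam_mono (lamo w); apply/fintype.subsetP => x' Ax'; rewrite !inE.
  by apply: contra_notN nox => /eqP<-; exists w.
have once := cover_once cardA cover.
have [i unsati] : exists i, ~ exists2 v, R v & forall j, lam (node i j) (A (node i j)) (v j).
  apply: contrapT => nexi; apply: unsatA.
  have sati i : exists v, R v /\ forall j, lam (node i j) (A (node i j)) (v j).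
    by apply: contrapT => nv; apply: nexi; exists i => -[v ? ?]; apply: nv; exists v.
  pose o (w : V) := sval (cid (sati (tag w))) (tagged w).
  have oE i := svalP (cid (sati i)).
  by exists o => [|[i j]]; [split=> // i | ]; case: (oE i).
(* An atom without variables could not be rooted. It holds in every solution with one leaf released,
   and [L_gt0] provides such a leaf, so it is not the refuted atom. *)
have [x0 _] : exists x0, x0 \in L by apply/card_gt0P.
have [o [Ro _] _] := sat x0.
have [ar0|ar_gt0] := posnP (ar i).
  case: unsati; exists (fun j => o (node i j)) => // j.
  by have := ltn_ord j; rewrite {2}ar0.
pose t : tree V := Node (@R i) (Ordinal ar_gt0) (fun j => Leaf k (node i j) (A (node i j))).
exists t; split=> [|x|[y [v [_ Rv lamv]]]|x] /=.
- by split.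
- under eq_bigr do rewrite muln1.
  rewrite -[leqRHS](once x) -big_mkcond /= !sum1_card.
  rewrite -(card_image (f := fun j => node i j)).
    apply/subset_leq_card/fintype.subsetP => w /imageP[j Axj ->].
    exact: Axj.
  by move=> j j' /eqP; rewrite eq_Tagged => /eqP.
- apply: unsati; exists v => // j; have := lamv j.
  by rewrite /switch setTI.
have [o' [Ro' _] lamo'] := sat x.
exists (o' (node i (Ordinal ar_gt0))), (fun j => o' (node i j)); split=> // j.
by apply: lam_mono (lamo' _); apply: subsetIl.
Qed.

(* The equality u = v is cut by unfolding the formula into a walk (cut_edge).
   Then the copies are split off the end of the walk one at a time and, seen
   from each of them, the rest of the formula hangs at u and v only, so that the
   induction hypothesis on E applies. Each round strictly decreases the number
   of leaves, weighted by their position, that are still inside the walk. *)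
Lemma resolve (E : seq (V * V)) (lam : V -> {set L} -> K -> Prop) :
  (forall w, switched1 (lam w)) ->
  ~ (exists2 o, formula E o & forall w, lam w [set: L] (o w)) ->
  (forall x, exists2 o, formula E o & forall w, lam w [set~ x] (o w)) ->
  exists t, resolved lam t.
Proof.
elim: E lam => [|[u v] E IHE] lam; first exact: resolve0.
move=> swl unsat sat.
(* The digraph obtained by dropping the equality of [u] and [v]. *)
pose Ef X (c c' : K) :=
  exists o, [/\ formula E o, o u = c, o v = c' & forall w, lam w X (o w)].
have swE : switched G a (fun X (z : bool -> K) => Ef X (z false) (z true)).
  pose P X (z : bool + V -> K) := (formula E (z \o inr) /\
    (z (inr u) = z (inl false) /\ z (inr v) = z (inl true))) /\
    forall w, lam w X (z (inr w)).
  apply: (@switched_ex _ _ _ _ _ V _ P); last first.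
    by move=> X z; split=> [[o [? ? ? ?]]|[o [[? [? ?]] ?]]]; exists o.
  apply: switched_and.
    apply: (@switched_hard _ _ _ _ _ (fun z => formula E (z \o inr) /\
      (z (inr u) = z (inl false) /\ z (inr v) = z (inl true)))).
    apply: pp_and; first exact: (pp_sub inr (pp_formula E)).
    by apply: pp_and; apply: pp_eq.
  by apply: switched_all => w; exact: (switched_sub (fun=> inr w) (swl w)).
have consE o : formula ((u, v) :: E) o <-> formula E o /\ o u = o v.
  split=> [[Ro Eo]|[[Ro Eo] ouv]].
    split; last by apply: (Eo (u, v)); rewrite mem_head.
    by split=> // e Ee; apply: Eo; rewrite inE Ee orbT.
  by split=> // e; rewrite inE => /predU1P[->|/Eo].
have noloop c : ~ Ef [set: L] c c.
  move=> [o [Fo ou ov lamo]]; apply: unsat; exists o => //.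
  by apply/consE; rewrite ou ov.
have loop x : exists c, Ef [set~ x] c c.
  have [o /consE[Fo ouv] lamo] := sat x.
  by exists (o u), o.
have [n [A [disjA unsatA]]] := cut_edge const_G max_p swE noloop loop.
pose D c := Ef set0 c c.
have ppD : pp G (fun z : unit -> K => D (z tt)).
  exact: (pp_sub (fun=> tt) (switched_fix const_G set0 swE)).
pose unary P : tree (V + nat) :=
  Node (fun z : 'I_1 -> K => P (z ord0)) ord0 (fun=> Top).
pose l := walk_end Ef A.
have swl2 j : switched1 (l j).
  elim: j => [|j IHj] /=; first exact: (switched_hard a ppD).
  apply: switched_and; first exact: (switched_hard a ppD).
  pose P X (z : unit + unit -> K) :=
    l j X (z (inr tt)) /\ Ef (X :&: A j) (z (inr tt)) (z (inl tt)).
  apply: (@switched_ex _ _ _ _ _ unit _ P).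
    apply: switched_and; first exact: (switched_sub inr IHj).
    exact: (switched_sub (fun b : bool => if b then inl tt else inr tt)
      (switched_restr (A j) swE)).
  move=> X z; split=> [[y ly Ey]|[y [ly Ey]]]; last by exists (y tt).
  by exists (fun=> y).
have l_ext j X X' y : (forall j', j' < j -> X :&: A j' = X' :&: A j') ->
    l j X y -> l j X' y.
  elim: j y => //= j IHj y eqX [Dy [z lz Ez]]; split=> //; exists z.
    by apply: IHj => // j' lt_j'; apply: eqX; apply: leqW.
  by rewrite -eqX.
have l_walk j X y : l j X y -> exists w, [/\ w j = y,
    forall j', j' <= j -> D (w j') & forall j', j' < j -> Ef (X :&: A j') (w j') (w j'.+1)].
  elim: j y => [|j IHj] y /=.
    by move=> Dy; exists (fun=> y); split.
  move=> [Dy [z /IHj[w [wz wD wE]] Ez]].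
  exists (fun j' => if j' <= j then w j' else y); split; first by rewrite ltnn.
    by move=> j' _; case: ifP => // /wD.
  move=> j'; rewrite ltnS => le_j'; rewrite le_j'.
  case: ltnP => [/wE //|le_j]; have -> : j' = j by apply/eqP; rewrite eqn_leq le_j'.
  by rewrite wz.
have lam_loop x : exists c, forall j, l j [set~ x] c.
  have [c Ec] := loop x; exists c.
  have sub (X : {set L}) : X \subset [set~ x] -> Ef X c c.
    by move=> subX; exact: (switched_mono (z := fun=> c) swE subX Ec).
  have Dc : D c by apply/sub/sub0set.
  by elim=> //= j IHj; split=> //; exists c => //; apply/sub/subsetIl.
pose lam2 : V + nat -> {set L} -> K -> Prop := glue lam l.
have swl3 w : switched1 (lam2 w) by case: w => [w|j]; [apply: swl | apply: swl2].
(* A walk with [j] edges weighs [j.+1], the original names nothing: splitting off the last copy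
   lowers the total. *)
pose wt : V + nat -> nat := glue (fun=> 0) succn.
suff inner c t : \sum_x weight wt t x < c -> resolved lam2 t ->
    exists t', resolved lam t'.
  apply: (inner _ (Leaf k (inr n) [set: L])); first exact: ltnSn.
  split=> //= [x||x]; first by rewrite muln1 leq_b1.
    move=> [y]; rewrite /switch setTI => /l_walk[w [_ wD wE]]; apply: unsatA.
    by exists w; [exact: wD | move=> j /wE; rewrite setTI].
  by have [c' lc'] := lam_loop x; exists c'; rewrite /switch setIT; apply: lc'.
elim: c t => // c IHc t; rewrite ltnS => le_c [ht cnt unsat_t sat_t].
have [x0 pos|wt0] := pickP (fun x => 0 < weight wt t x); last first.
  (* Total weight 0: walks occur only with no leaf switched on, where they are leaf-free unary
     predicates, so only names from [lam] remain. *)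
  pose s : V + nat -> tree V := glue (fun w => Leaf k w [set: L])
    (fun j => Node (fun z : 'I_1 -> K => l j set0 (z ord0)) ord0 (fun=> Top)).
  have ppl j : pp G (fun z : 'I_1 -> K => l j set0 (z ord0)).
    exact: (pp_sub (fun=> ord0) (switched_fix const_G set0 (swl2 j))).
  have sE X y : eval (switch lam X) (subst s t) y <-> eval (switch lam2 X) t y.
    have {}wt0 x : weight wt t x = 0.
      by apply/eqP; rewrite -leqn0 leqNgt; apply: negbT (wt0 x).
    rewrite eval_switch_subst; clear -wt0; elim: t y wt0 => //=.
    - move=> [w|j] B y wB; rewrite /switch /= ?setIT //.
      have -> : B = set0.
        by apply/setP => x; have := wB x; rewrite in_set0; case: (x \in B).
      rewrite setI0; split=> [[z [<-]]//|ly]; exists (fun=> y); split=> //.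
    - by move=> s' IHs t IHt y wst; rewrite IHs ?IHt // => x;
        apply/eqP; have /eqP := wst x; rewrite addn_eq0 => /andP[].
    move=> m R' j ch IHch y wch; have wch0 i x : weight wt (ch i) x = 0.
      by apply/eqP; have /eqP := wch x; rewrite sum_nat_eq0 => /forallP/(_ i).
    by split=> -[z [? ? chz]]; exists z; split=> // i; apply/IHch.
  exists (subst s t); split.
  - apply: hard_subst => // -[w|j] //=; split=> //.
  - move=> x; apply: leq_trans (weight_subst (c := 1) _ _) _; last by rewrite muln1.
    by case=> [w|j] /=; rewrite ?muln1 ?leq_b1 // big1.
  - by move=> [y /sE ty]; apply: unsat_t; exists y.
  - by move=> x; have [y ty] := sat_t x; exists y; apply/sE.
have hTop : hard G Q (Top : tree (V + nat)) by [].
have [w [B [U [[Bx0 wtw] hU wE uE]]]] := reroot ht hTop pos.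
have tE X : (exists y, eval (switch lam2 X) t y) <->
    (exists2 y, lam2 w (X :&: B) y & eval (switch lam2 X) U y).
  rewrite -[X in _ <-> X]uE; split=> [[y ty]|[y ty _]]; exists y => //.
(* Positive weight means that [w] names a walk. A walk without edges imposes only [D] on the
   root. *)
case: w wtw wE uE tE => // -[|j] _ /= wE _ tE.
  apply: (IHc (And (unary D) U)).
    have wtU x : weight wt (And (unary D) U) x = weight wt U x by rewrite /= big1.
    have wtE x : weight wt t x = (x \in B) + weight wt U x.
      by rewrite -[LHS]addn0 (wE wt) /= muln1.
    apply: leq_trans le_c; rewrite (eq_bigr _ (fun x _ => wtU x)).
    rewrite (bigD1 x0) //= [ltnRHS](bigD1 x0) //= wtE Bx0 -addSn add1n leq_add //.
    by apply: leq_sum => x _; rewrite wtE leq_addl.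
  have uE X y : eval (switch lam2 X) (And (unary D) U) y <->
      D y /\ eval (switch lam2 X) U y.
    split=> [[[z [<-]]]//|[Dy Uy]]; split=> //.
    by exists (fun=> y); split.
  split=> [|x||x].
  - by split=> //; split=> //; exact: (pp_sub (fun=> ord0) ppD).
  - apply: leq_trans (cnt x); rewrite -[leqRHS]addn0 (wE (fun=> 1)) /=.
    by rewrite big1 // add0n leq_addl.
  - move=> [y /uE[Dy Uy]]; apply: unsat_t; apply/tE; by exists y.
  - by have /tE[y Dy Uy] := sat_t x; exists y; apply/uE.
(* In the last copy of the formula the active leaves are those in [A j]. The shorter walk hangs at
   [u]; the condition [D] on the end of the walk and the rest [U] of the tree hang at [v]. *)
pose s w : tree (V + nat) := And (Leaf k (inl w) (B :&: A j))
  (And (if w == v then And (unary D) U else Top)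
       (if w == u then Leaf k (inr j) (B :\: A j) else Top)).
have hs w : hard G Q (s w).
  do 2?split=> //; case: ifP => //= _; do 2?split=> //.
  exact: (pp_sub (fun=> ord0) ppD).
pose lams w X := eval (switch lam2 X) (s w).
have swls w : switched1 (lams w) by apply: switched_eval.
have lamsE X : (exists2 o, formula E o & forall w, lams w X (o w)) <->
    exists y, eval (switch lam2 X) t y.
  rewrite tE /=; split=> [[o Fo lamo]|[y [Dy [z lz [o [Fo ou ov lamo]]]] Uy]].
    have [_ []] := lamo v; rewrite eqxx => -[[z [zv Dz _]] Uv] _.
    have [_ [_]] := lamo u; rewrite eqxx /switch /= => lu.
    exists (o v) => //; split; first by rewrite -zv.
    exists (o u).
      (* The copies carry disjoint sets of leaves, so removing [A j] does not affect the shorter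
         walk. *)
      apply: l_ext lu => j' lt_j'; apply/setP => x; rewrite !inE.
      case Aj': (x \in A j'); rewrite ?andbF // !andbT.
      case Aj: (x \in A j) => //=.
      by move: lt_j'; rewrite (disjA x j' j) // ltnn.
    exists o; split=> // w; have [] := lamo w.
    by rewrite /switch /= setIA.
  exists o => // w; split; first by rewrite /switch /= setIA.
  split; case: eqP => // ->.
    rewrite ov; split=> //; exists (fun=> y); split=> //.
  rewrite ou /switch /=; apply: l_ext lz => j' lt_j'; apply/setP => x; rewrite !inE.
  case Aj': (x \in A j'); rewrite ?andbF // !andbT.
  case Aj: (x \in A j) => //=.
  by move: lt_j'; rewrite (disjA x j' j) // ltnn.
have [|x|t' [ht' cnt' unsat' sat']] := IHE lams swls.
- by move/lamsE.
- exact/lamsE/sat_t.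
have st'E X y := eval_switch_subst lam2 s X t' y.
have split_B x : (x \in B :&: A j) + (x \in B :\: A j) = (x \in B) :> nat.
  by rewrite !inE; case: (x \in B); case: (x \in A j).
(* [B] is split between the last copy and the shorter walk, so no leaf is duplicated, and the weight
   factor of the leaves in [B] falls from [j.+2] to at most [j.+1]. *)
have s_bound (wt' : V + nat -> nat) c' x w' :
    (forall w', wt' (inl w') <= c') -> wt' (inr j) <= c' ->
    weight wt' (s w') x <= (x \in B) * c' + weight wt' U x.
  move=> le_l le_r; rewrite -split_B mulnDl /= -addnA leq_add ?leq_mul //.
  rewrite addnC; apply: leq_add; last by case: ifP => _ //=; rewrite big1.
  by case: ifP => _ //=; rewrite leq_mul.
apply: (IHc (subst s t')).
  apply: leq_trans le_c; rewrite (bigD1 x0) //= [ltnRHS](bigD1 x0) //=.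
  have le x : weight wt (subst s t') x <= (x \in B) * j.+1 + weight wt U x.
    apply: leq_trans (weight_subst _ (fun w' => s_bound wt j.+1 x w' _ _)) _ => //.
    by rewrite -[leqRHS]mul1n leq_mul.
  rewrite -addSn leq_add //.
    apply: leq_ltn_trans (le x0) _.
    by rewrite -[ltnRHS]addn0 (wE wt) Bx0 !mul1n /= ltn_add2r.
  apply: leq_sum => x _; apply: leq_trans (le x) _.
  by rewrite -[leqRHS]addn0 (wE wt) leq_add2r leq_mul //= leqnSn.
split.
- exact: hard_subst.
- move=> x; apply: leq_trans (weight_subst _ (fun w' => s_bound (fun=> 1) 1 x w' _ _)) _ => //.
  rewrite -(wE (fun=> 1)) /= addn0; apply: leq_trans (leq_mul (cnt' x) (cnt x)) _.
  by [].
- by move=> [y /st'E ty]; apply: unsat'; exists y.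
- by move=> x; have [y ty] := sat' x; exists y; apply/st'E.
Qed.

End Formula.
End Acyclic.

(** * Chains in acyclic formulas *)

Section ChainForm.
Variables (k : nat) (G : Rk k -> Prop).
Hypothesis const_G : forall a : 'I_k, G (rho_eq_const a).

Local Notation K := 'I_k.
Local Notation pp2 R := (pp G (fun v : 'I_2 -> K => R (v ord0) (v ord_max))).
Local Notation pp3 R :=
  (pp G (fun v : 'I_3 -> K => R (v ord0) (v (Ordinal (isT : 1 < 3))) (v ord_max))).

(* [C xs y] is a chain started at y and absorbing xs 0, .., xs n.-1 in turn. *)
Fixpoint chain_form n (C : (nat -> K) -> K -> Prop) : Prop :=
  match n with
  | 0 => False
  | 1 => exists2 R : K -> K -> Prop, pp2 R & forall xs y, C xs y <-> R y (xs 0)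
  | n'.+1 => exists (R : K -> K -> K -> Prop) C', [/\ pp3 R, chain_form n' C' &
      forall xs y, C xs y <-> exists2 z, R y (xs 0) z & C' (fun t => xs t.+1) z]
  end.

Lemma chain_form_ext n (C C' : (nat -> K) -> K -> Prop) :
  (forall xs y, C' xs y <-> C xs y) -> chain_form n C -> chain_form n C'.
Proof.
move=> E; case: n => // -[|n].
  by move=> [R ppR CE]; exists R => // xs y; rewrite E.
by move=> [R [C1 [ppR C1n CE]]]; exists R, C1; split=> // xs y; rewrite E.
Qed.

Lemma chain_form_cons n (R : K -> K -> K -> Prop) C C' :
  pp3 R -> chain_form n C' ->
  (forall xs y, C xs y <-> exists2 z, R y (xs 0) z & C' (fun t => xs t.+1) z) ->
  chain_form n.+1 C.
Proof. by case: n => // n *; exists R, C'. Qed.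

(** [H] is absorbed into the first link of the chain. *)
Lemma chain_form_comp n (H : K -> K -> Prop) C :
  pp2 H -> chain_form n C ->
  chain_form n (fun xs y => exists2 z, H y z & C xs z).
Proof.
move=> ppH; case: n => // -[|n].
  move=> [R ppR CE]; exists (fun y x => exists2 z, H y z & R z x); last first.
    by move=> xs y; split=> -[z Hz] => [/CE|] ?; exists z => //; apply/CE.
  apply: (@pp_exI _ _ _ unit _ (fun t => H (t (inl ord0)) (t (inr tt)) /\
    R (t (inr tt)) (t (inl ord_max)))).
    apply: pp_and.
      exact: (pp_sub (fun i : 'I_2 => if i == ord0 then inl ord0 else inr tt) ppH).
    exact: (pp_sub (fun i : 'I_2 => if i == ord0 then inr tt else inl ord_max) ppR).
  by move=> v; split=> [[z ? ?]|[z [? ?]]]; [exists (fun=> z) | exists (z tt)].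
move=> [R [C1 [ppR C1n CE]]].
apply: (@chain_form_cons n.+1 (fun y x z => exists2 z', H y z' & R z' x z) _ C1 _ C1n).
  pose o1 : 'I_3 := Ordinal (isT : 1 < 3).
  apply: (@pp_exI _ _ _ unit _ (fun t => H (t (inl ord0)) (t (inr tt)) /\
    R (t (inr tt)) (t (inl o1)) (t (inl ord_max)))).
    apply: pp_and.
      exact: (pp_sub (fun i : 'I_2 => if i == ord0 then inl ord0 else inr tt) ppH).
    exact: (pp_sub (fun i : 'I_3 => if i == ord0 then inr tt else inl i) ppR).
  by move=> v; split=> [[z ? ?]|[z [? ?]]]; [exists (fun=> z) | exists (z tt)].
move=> xs y; split=> [[z' Hz' /CE[z Rz C1z]]|[z [z' Hz' Rz] C1z]].
  by exists z => //; exists z'.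
by exists z' => //; apply/CE; exists z.
Qed.

(** The nested existentials are gathered into one sequence [w], the shape used by [chain]. *)
Lemma chain_form_path n C :
  chain_form n.+1 C ->
  exists (R : nat -> K -> K -> K -> Prop) (S : K -> K -> Prop),
    [/\ forall t, pp3 (R t), pp2 S & forall xs y, C xs y <->
      exists w : nat -> K,
        [/\ w 0 = y, forall t, t < n -> R t (w t) (xs t) (w t.+1) & S (w n) (xs n)]].
Proof.
elim: n C => [|n IHn] C.
  move=> [S ppS CE]; exists (fun _ _ _ _ => True), S; split=> // [_|xs y].
    exact: pp_true.
  by rewrite CE; split=> [Sy|[w [<- _]]//]; exists (fun=> y).
move=> [R0 [C' [ppR0 /IHn[R [S [ppR ppS C'E]]] CE]]].
exists (fun t => if t is t'.+1 then R t' else R0), S; split=> // [[|t]//|xs y].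
rewrite CE; split=> [[z R0z /C'E[w [w0 Rw Sw]]]|[w [w0 Rw Sw]]].
  exists (fun t => if t is t'.+1 then w t' else y); split=> // -[|t] lt_t.
    by rewrite w0.
  exact: Rw.
exists (w 1); first by rewrite -w0; apply: (Rw 0).
by apply/C'E; exists (fun t => w t.+1); split=> // t lt_t; apply: (Rw t.+1).
Qed.

(** * Extracting a chain from a tree in which no leaf is repeated *)

Section LongChain.
Variables (L : finType) (a : L -> K) (Q : nat).

Local Notation tree := (tree k L L).

(** The constants at the leaves become free variables [v]. *)
Definition eval_at (t : tree) (v : L -> K) : K -> Prop :=
  eval (fun i B y => i \in B -> y = v i) t.

Fixpoint leaves (t : tree) : {set L} :=
  match t with
  | Top => set0
  | Leaf i B => [set i] :&: B
  | And s t => leaves s :|: leaves t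
  | Node m _ _ ch => \bigcup_(i < m) leaves (ch i)
  end.

Lemma weight_leaves (t : tree) i : i \in leaves t -> 0 < weight (fun=> 1) t i.
Proof.
elim: t => [|j B|s IHs t IHt|m R j ch IHch] /=.
- by rewrite inE.
- by rewrite !inE => /andP[/eqP-> ->].
- by rewrite inE addn_gt0 => /orP[/IHs->|/IHt->]; rewrite ?orbT.
- by move=> /bigcupP[j' _ /IHch pos]; rewrite (bigD1 j') //= addn_gt0 pos.
Qed.

Lemma eval_at_leaves (t : tree) v v' y :
  {in leaves t, v =1 v'} -> eval_at t v y -> eval_at t v' y.
Proof.
rewrite /eval_at; elim: t y => [|j B|s IHs t IHt|m R j ch IHch] y //= eqv.
- by move=> yE Bj; rewrite yE // eqv // !inE eqxx.
- move=> [/IHs sy /IHt ty]; split; [apply: sy | apply: ty] => i si;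
    by apply: eqv; rewrite inE si ?orbT.
- move=> [u [uj Ru chu]]; exists u; split=> // i; apply: IHch (chu i) => i' ch_i'.
  by apply: eqv; apply/bigcupP; exists i.
Qed.

Lemma pp_eval_at (t : tree) :
  hard G Q t -> pp G (fun v : option L -> K => eval_at t (v \o Some) (v None)).
Proof.
rewrite /eval_at; elim: t => [|j B|s IHs t IHt|m R j ch IHch] /=.
- by move=> _; apply: pp_true.
- move=> _; case: (boolP (j \in B)) => Bj.
    by apply: pp_ext (pp_eq G None (Some j)) _ => v; split=> // ->.
  by apply: pp_ext (pp_true G _) _ => v; split.
- by move=> [/IHs ? /IHt ?]; apply: pp_and.
move=> [_ ppR hch].
pose f i (x : option L) : option L + 'I_m := if x is Some l then inl (Some l) else inr i.
apply: (@pp_exI _ _ _ 'I_m _ (fun u => u (inr j) = u (inl None) /\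
  (R (u \o inr) /\ forall i, eval (fun l B y => l \in B -> y = u (inl (Some l)))
                                  (ch i) (u (inr i))))).
  apply: pp_and; first exact: pp_eq.
  apply: pp_and; first exact: pp_sub.
  by apply: pp_all => i; exact: (pp_sub (f i) (IHch i (hch i))).
by move=> v; split=> [[u [? ? ?]]|[u [? [? ?]]]]; exists u.
Qed.

(** The leaves in [s] are the arguments, in the order of [s]; the others keep their constants. *)
Definition override (s : seq L) (xs : nat -> K) (i : L) : K :=
  if i \in s then xs (index i s) else a i.

Definition has_chain (t : tree) m : Prop :=
  exists s : seq L, [/\ size s = m, uniq s, {subset s <= leaves t} &
    chain_form m (fun xs => eval_at t (override s xs))].

Section Subtree.
(** [H] is the part of [t] outside the subtree [u]; it links the root of [t] to the root of [u] and
    does not read the leaves of [u]. *)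
Variables (t u : tree) (H : (L -> K) -> K -> K -> Prop).
Hypothesis pp_H : pp G (fun z : L + bool -> K =>
  H (z \o inl) (z (inr false)) (z (inr true))).
Hypothesis t_u : forall v y, eval_at t v y <-> exists2 z, H v y z & eval_at u v z.
Hypothesis H_dep : forall v v' y z,
  (forall i, i \notin leaves u -> v i = v' i) -> H v y z -> H v' y z.
Hypothesis sub_ut : leaves u \subset leaves t.

(** With the leaves outside [u] fixed to constants, [H] is a binary relation and merges into the
    first link. *)
Lemma has_chain_subtree m : has_chain u m -> has_chain t m.
Proof.
move=> [s [sz us sub_s Cs]]; exists s; split=> //.
  by move=> i /sub_s; apply: (fintype.subsetP sub_ut).
have ppHa : pp2 (H a).
  apply: (pp_ext (pp_subst const_G (fun z : L + bool => match z with
    | inl i => inr (a i) | inr b => inl (if b then ord_max else ord0) end) pp_H)).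
  by move=> v.
apply: chain_form_ext (chain_form_comp ppHa Cs) => xs y.
rewrite t_u; split=> -[z Hz uz]; exists z => //; apply: H_dep Hz => i;
  by rewrite /override; case: ifP => // /sub_s ->.
Qed.

(** Keeping one leaf [i] outside [u] free turns [H] into a ternary relation, a new first link that
    absorbs [i]. *)
Lemma has_chain_side m i :
  i \in leaves t -> i \notin leaves u -> has_chain u m -> has_chain t m.+1.
Proof.
move=> ti nui [s [sz us sub_s Cs]]; exists (i :: s).
have nsi : i \notin s by apply: contra nui => /sub_s.
split=> /=.
- by rewrite sz.
- by rewrite nsi.
- by move=> j; rewrite inE => /predU1P[->//|/sub_s]; apply: (fintype.subsetP sub_ut).
pose ai x j := if j == i then x else a j.
have ppR : pp3 (fun y x z => H (ai x) y z).
  apply: (pp_ext (pp_subst const_G (fun z : L + bool => match z with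
    | inl j => if j == i then inl (Ordinal (isT : 1 < 3)) else inr (a j)
    | inr b => inl (if b then ord_max else ord0) end) pp_H)).
  by move=> v; split; apply: H_dep => j _ /=; rewrite /ai; case: ifP.
apply: (@chain_form_cons m (fun y x z => H (ai x) y z) _ _ ppR Cs) => xs y.
rewrite t_u.
split=> -[z Hz uz]; exists z.
- apply: (H_dep _ Hz) => j nuj; rewrite /override /ai inE /= eq_sym.
  case: eqP => //= _; case: ifP => // sj.
  by rewrite (sub_s _ sj) in nuj.
- apply: eval_at_leaves uz => j uj; rewrite /override inE /= eq_sym.
  by case: eqP => //= ij; rewrite ij uj in nui.
- apply: (H_dep _ Hz) => j nuj; rewrite /override /ai inE /= eq_sym.
  case: eqP => //= _; case: ifP => // sj.
  by rewrite (sub_s _ sj) in nuj.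
- apply: eval_at_leaves uz => j uj; rewrite /override inE /= eq_sym.
  by case: eqP => //= ij; rewrite ij uj in nui.
Qed.

End Subtree.

Lemma has_chain_gt0 t m : has_chain t m -> 0 < m.
Proof. by case: m => // -[? [? ? ? []]]. Qed.

(** A branching with leaves in one part only passes the chain up. With leaves in several parts it
    costs a factor of at most [b], but the longest chain gains a leaf. The exponent is [m.-1]
    because a single leaf is already a chain of length 1. *)
Lemma extract_chain b (t : tree) : 1 < b -> Q <= b -> hard G Q t ->
  (forall i, weight (fun=> 1) t i <= 1) -> leaves t != set0 ->
  exists2 m, has_chain t m & #|leaves t| <= b ^ m.-1.
Proof.
move=> b_gt1 leQb; elim: t => [|j B|s IHs t IHt|m R j ch IHch] ht cnt.
- by rewrite eqxx.
- rewrite /= => /set0Pn[i]; rewrite !inE => /andP[/eqP-> Bj].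
  exists 1; last by rewrite expn0 (leq_trans (subset_leq_card (subsetIl _ _))) ?cards1.
  exists [:: j]; split=> //=.
    by move=> i'; rewrite !inE => /eqP->; rewrite eqxx.
  exists (fun y x => y = x); first exact: pp_eq.
  by move=> xs y; rewrite /eval_at /= /override !inE /= eqxx; split=> [/(_ Bj)|].
- have [hs ht'] := ht.
  have cnts i : weight (fun=> 1) s i <= 1 by apply: leq_trans (cnt i); apply: leq_addr.
  have cntt i : weight (fun=> 1) t i <= 1 by apply: leq_trans (cnt i); apply: leq_addl.
  (* No leaf is repeated, so the two parts have disjoint leaves; this gives the independence
     required of [H]. *)
  have disj i : i \in leaves s -> i \in leaves t -> False.
    move=> /weight_leaves si /weight_leaves ti; have := cnt i.
    by rewrite leqNgt /= -[2]/(1 + 1)%N leq_add.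
  pose Hs v y z := y = z /\ eval_at t v z.
  pose Ht v y z := y = z /\ eval_at s v z.
  have ppHside u : hard G Q u -> pp G (fun z : L + bool -> K =>
      z (inr false) = z (inr true) /\ eval_at u (z \o inl) (z (inr true))).
    move=> hu; apply: pp_and; first exact: pp_eq.
    exact: (pp_sub (fun x => if x is Some l then inl l else inr true) (pp_eval_at hu)).
  have chain_s m : has_chain s m -> has_chain (And s t) m.
    apply: (@has_chain_subtree _ _ Hs); first exact: ppHside.
    - by move=> v y; split=> [[sy ty]|[z [-> tz] sz]//]; exists y.
    - move=> v v' y z eqv [-> tz]; split=> //; apply: eval_at_leaves tz => i ti.
      by apply: eqv; apply/negP => /disj; apply.
    - exact: subsetUl.
  have chain_t m : has_chain t m -> has_chain (And s t) m.
    apply: (@has_chain_subtree _ _ Ht); first exact: ppHside.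
    - by move=> v y; split=> [[sy ty]|[z [-> tz] sz]//]; exists y.
    - move=> v v' y z eqv [-> tz]; split=> //; apply: eval_at_leaves tz => i ti.
      by apply: eqv; apply/negP => /(disj _ ti).
    - exact: subsetUr.
  have [s0|ns0] := eqVneq (leaves s) set0.
    by rewrite /= s0 set0U => /(IHt ht' cntt)[m /chain_t]; exists m.
  have [t0|nt0 _] := eqVneq (leaves t) set0.
    by rewrite /= t0 setU0 => /(IHs hs cnts)[m /chain_s]; exists m.
  have [ms cs les] := IHs hs cnts ns0; have [mt ct let_] := IHt ht' cntt nt0.
  have [xs xsP] := set0Pn _ ns0; have [xt xtP] := set0Pn _ nt0.
  have chain_s1 m : has_chain s m -> has_chain (And s t) m.+1.
    apply: (@has_chain_side _ _ Hs _ _ _ _ _ xt); first exact: ppHside.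
    - by move=> v y; split=> [[sy ty]|[z [-> tz] sz]//]; exists y.
    - move=> v v' y z eqv [-> tz]; split=> //; apply: eval_at_leaves tz => i ti.
      by apply: eqv; apply/negP => /disj; apply.
    - exact: subsetUl.
    - by rewrite inE xtP orbT.
    - by apply/negP => /disj; apply.
  have chain_t1 m : has_chain t m -> has_chain (And s t) m.+1.
    apply: (@has_chain_side _ _ Ht _ _ _ _ _ xs); first exact: ppHside.
    - by move=> v y; split=> [[sy ty]|[z [-> tz] sz]//]; exists y.
    - move=> v v' y z eqv [-> tz]; split=> //; apply: eval_at_leaves tz => i ti.
      by apply: eqv; apply/negP => /(disj _ ti).
    - exact: subsetUr.
    - by rewrite inE xsP.
    - by apply/negP => /(disj _ xsP).
  have bound m : ms <= m -> mt <= m -> #|leaves (And s t)| <= b ^ m.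
    move=> le_ms le_mt; have m_gt0 : 0 < m by apply: leq_trans (has_chain_gt0 cs) _.
    apply: leq_trans (leq_card_setU _ _) _; rewrite -(prednK m_gt0) expnS.
    apply: leq_trans (leq_mul b_gt1 (leqnn _)); rewrite mul2n -addnn.
    by rewrite leq_add // (leq_trans les, leq_trans let_) // leq_pexp2l ?(ltnW b_gt1) //
      -!subn1 leq_sub2r.
  case: (leqP mt ms) => le_m.
    by exists ms.+1; [apply: chain_s1 | apply: bound].
  by exists mt.+1; [apply: chain_t1 | apply: bound => //; apply: ltnW].
have [leQ ppR hch] := ht.
have cntch i x : weight (fun=> 1) (ch i) x <= 1.
  by apply: leq_trans (cnt x); rewrite /= (bigD1 i) //= leq_addr.
have disj i i' x : i != i' -> x \in leaves (ch i) -> x \in leaves (ch i') -> False.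
  move=> neq /weight_leaves pos /weight_leaves pos'; have := cnt x.
  rewrite /= (bigD1 i) //= (bigD1 i') /= 1?eq_sym // leqNgt -[2]/(1 + 1)%N.
  by rewrite leq_add // (leq_trans pos') // leq_addr.
(* The node as seen from child [i]: everything but the subtree at [i]. *)
pose H i v y z := exists w : 'I_m -> K, [/\ w j = y, w i = z, R w &
  forall i', i' != i -> eval_at (ch i') v (w i')].
have ppH i : pp G (fun z : L + bool -> K =>
    H i (z \o inl) (z (inr false)) (z (inr true))).
  apply: (@pp_exI _ _ _ 'I_m _ (fun z => (z (inr j) = z (inl (inr false)) /\
    z (inr i) = z (inl (inr true))) /\ (R (z \o inr) /\
    forall i', i' != i -> eval_at (ch i') (z \o inl \o inl) (z (inr i'))))).
    apply: pp_and; first by apply: pp_and; apply: pp_eq.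
    apply: pp_and; first exact: pp_sub.
    apply: pp_all => i'; case: eqP => _; first by apply: pp_ext (pp_true G _) _ => v; split.
    apply: pp_ext (pp_sub (fun x : option L => if x is Some l then inl (inl l) else inr i')
      (pp_eval_at (hch i'))) _ => v.
    by split=> [/(_ isT)|].
  by move=> v; split=> [[w [? ? ? ?]]|[w [[? ?] [? ?]]]]; exists w.
have tE i v y : eval_at (Node R j ch) v y <->
    exists2 z, H i v y z & eval_at (ch i) v z.
  split=> [[w [wj Rw chw]]|[z [w [wj wi Rw chw]] chz]].
    by exists (w i); [exists w; split=> // i' _; apply: chw | apply: chw].
  exists w; split=> // i'; have [->|/chw //] := eqVneq i' i.
  by rewrite wi.
have H_dep i v v' y z : (forall x, x \notin leaves (ch i) -> v x = v' x) ->
    H i v y z -> H i v' y z.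
  move=> eqv [w [wj wi Rw chw]]; exists w; split=> // i' neq.
  apply: eval_at_leaves (chw i' neq) => x x_i'; apply: eqv; apply/negP => x_i.
  exact: (disj _ _ _ neq x_i' x_i).
have sub_ch i : leaves (ch i) \subset leaves (Node R j ch) by apply: bigcup_sup.
have chain_ch i n : has_chain (ch i) n -> has_chain (Node R j ch) n.
  exact: (has_chain_subtree (ppH i) (tE i) (@H_dep i) (sub_ch i)).
have chain_side i i' n : i' != i -> leaves (ch i') != set0 ->
    has_chain (ch i) n -> has_chain (Node R j ch) n.+1.
  move=> neq /set0Pn[x x_i']; apply: (has_chain_side (ppH i) (tE i) (@H_dep i) (sub_ch i)).
    exact: (fintype.subsetP (sub_ch i')) x_i'.
  by apply/negP; apply: disj x_i'.
have chains i : exists n, leaves (ch i) != set0 ->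
    has_chain (ch i) n /\ #|leaves (ch i)| <= b ^ n.-1.
  have [->|nz] := eqVneq (leaves (ch i)) set0; first by exists 0.
  by have [n ? ?] := IHch i (hch i) (cntch i) nz; exists n.
have [mm mmP] := choice chains.
move=> /set0Pn[x /bigcupP[i0 _ x_i0]].
have nz0 : leaves (ch i0) != set0 by apply/set0Pn; exists x.
have [i nzi maxi] := arg_maxnP (P := fun i => leaves (ch i) != set0) mm nz0.
have [chi lei] := mmP i nzi.
have [/existsP[i' /andP[neq nzi']]|none] :=
    boolP [exists i', (i' != i) && (leaves (ch i') != set0)].
  exists (mm i).+1; first exact: chain_side neq nzi' chi.
  apply: leq_trans (_ : \sum_i' #|leaves (ch i')| <= _) => /=.
    elim/big_ind2: _ => [|X c Y d leX leY|i'' _]; rewrite ?cards0 //.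
    exact: leq_trans (leq_card_setU _ _) (leq_add leX leY).
  rewrite -[X in b ^ X](prednK (has_chain_gt0 chi)) expnS.
  apply: leq_trans (leq_mul (leq_trans leQ leQb) (leqnn _)).
  rewrite -[m in m * _]card_ord -sum_nat_const; apply: leq_sum => i'' _.
  have [->|nz''] := eqVneq (leaves (ch i'')) set0; first by rewrite cards0.
  have [_ le''] := mmP _ nz''; apply: leq_trans le'' _.
  rewrite leq_pexp2l ?(ltnW b_gt1) // -!subn1 leq_sub2r //.
  exact: maxi.
exists (mm i); first exact: chain_ch chi.
apply: leq_trans lei; apply/subset_leq_card/bigcupsP => i' _.
have [->//|neq] := eqVneq i' i.
apply/fintype.subsetP => z z_i'; case/negP: none; apply/existsP; exists i'.
by rewrite neq; apply/set0Pn; exists z.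
Qed.

(** Since [x] occurs at most once, the value taken at its occurrence when it is switched off can
    serve as its new constant; two occurrences might need different values. *)
Lemma eval_switch_off (t : tree) x y :
  weight (fun=> 1) t x <= 1 ->
  eval (switch (fun i X z => i \in X -> z = a i) [set~ x]) t y ->
  exists c, eval_at t (fun i => if i == x then c else a i) y.
Proof.
rewrite /eval_at.
have off u z c : x \notin leaves u ->
    eval (switch (fun i X z => i \in X -> z = a i) [set~ x]) u z ->
    eval_at u (fun i => if i == x then c else a i) z.
  move=> nux uz; apply: (@eval_at_leaves _ a) => [i ui|].
    by case: eqP ui => // ->; rewrite (negbTE nux).
  rewrite /eval_at; elim: u z nux uz => [|i B|s IHs t' IHt|m R j ch IHch] z //=.
  - rewrite !inE /switch => nxi zE Bi; apply: zE; rewrite !inE Bi andbT.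
    by apply: contraNneq nxi => <-; rewrite eqxx Bi.
  - by rewrite inE negb_or => /andP[nxs nxt] [sz tz]; split; [apply: IHs | apply: IHt].
  - move=> nx [w [wj Rw chw]]; exists w; split=> // i; apply: IHch (chw i).
    by apply: contra nx => x_i; apply/bigcupP; exists i.
elim: t y => [|i B|s IHs t IHt|m R j ch IHch] y /=.
- by move=> _ _; exists y.
- rewrite /switch => _ yE; exists y => Bi; case: eqP => // neq.
  by apply: yE; rewrite !inE Bi andbT; apply/eqP.
- move=> cnt [sy ty]; case: (boolP (x \in leaves s)) => xs.
    have nxt : x \notin leaves t.
      apply/negP => xt; move: cnt; rewrite leqNgt -[2]/(1 + 1)%N.
      by rewrite leq_add // weight_leaves.
    have [c sc] := IHs y (leq_trans (leq_addr _ _) cnt) sy.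
    by exists c; split=> //; apply: off.
  have [c tc] := IHt y (leq_trans (leq_addl _ _) cnt) ty.
  by exists c; split=> //; apply: off.
move=> cnt [w [wj Rw chw]].
have cntch i : weight (fun=> 1) (ch i) x <= 1.
  by apply: leq_trans cnt; rewrite (bigD1 i) //= leq_addr.
have [[i x_i]|none] := pselect (exists i, x \in leaves (ch i)); last first.
  exists (a x), w; split=> // i; apply: off (chw i).
  by apply/negP => x_i; apply: none; exists i.
have [c chc] := IHch i (w i) (cntch i) (chw i).
exists c, w; split=> // i'; have [->//|neq] := eqVneq i' i.
apply: off (chw i'); apply/negP => x_i'; move: cnt.
rewrite (bigD1 i) //= (bigD1 i') //= leqNgt -[2]/(1 + 1)%N.
by rewrite leq_add ?weight_leaves // (leq_trans (weight_leaves x_i')) // leq_addr.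
Qed.

End LongChain.
End ChainForm.

(** * From an essential predicate of maximal arity to a long chain *)

Section Main.
Variables (k : nat) (G : Rk k -> Prop) (q : nat).
Hypothesis const_G : forall a : 'I_k, G (rho_eq_const a).
Hypothesis k_gt1 : 1 < k.
Hypothesis arity_G : forall P, G P -> arity P <= q.

Local Notation K := 'I_k.

Lemma q_gt0 : 0 < q.
Proof. exact: arity_G (const_G (Ordinal k_gt1)). Qed.

Lemma arity_basic P : basic G P -> arity P <= maxn q 2.
Proof.
case=> [/arity_G leq|[->|->]] //; last exact: leq_maxr.
exact: leq_trans leq (leq_maxl _ _).
Qed.

(** This gives [p >= 2], which excludes a chain with a single leaf. *)
Lemma rho_eq_essential : pp_closure G (rho_eq k) /\ essential (rho_eq k).
Proof.
pose P (v : 'I_2 -> K) := v ord0 = v ord_max.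
have -> : rho_eq k = mkRk (rpred_of P).
  congr (mkRk _); apply/ffunP => t; rewrite !ffunE.
  by apply/eqP/asboolP.
split; first by apply: pp_closure_rpred_of; apply: pp_eq.
pose c0 : K := Ordinal (ltnW k_gt1); pose c1 : K := Ordinal k_gt1.
apply: (@critical_essential _ _ _ [tuple c0; c1]).
  by rewrite ffunE; apply/asboolPn; rewrite /P !(tnth_nth c0).
move=> j; exists (if j == ord0 then c1 else c0).
rewrite ffunE; apply/asboolP; rewrite /P !tnth_mktuple !(tnth_nth c0) /=.
by case: j => -[|[|//]].
Qed.

(** A critical tuple supplies the constants [a]: fixing the free variables to them refutes the
    formula, and releasing any one restores satisfiability, as [resolve] requires. *)
Lemma acyclic_essential n (r : rpred k n.+1) :
  pp_closure G (mkRk r) -> essential (mkRk r) ->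
  (forall P, pp_closure G P -> essential P -> arity P <= n.+1) ->
  exists (a : 'I_n.+1 -> K) (t : tree k 'I_n.+1 'I_n.+1),
    resolved G (maxn q 2) (fun i X y => i \in X -> y = a i) t.
Proof.
move=> [l [m [A [GA rE]]]] /essential_critical[tp nrt relax] max_p.
pose a i := tnth tp i; exists a.
pose Vr := ('I_n.+1 + 'I_l)%type.
have bA j : basic G (atom_pred (A j)).
  by case: (GA j) => [|[|]]; [left | right; left | right; right].
pose I := (Vr + 'I_m)%type.
(* Each variable gets a trivial unary atom and each occurrence in an atom a variable of its own; the
   list [E] below ties occurrences to variables. *)
pose ar (i : I) := match i with inl _ => 1 | inr j => arity (atom_pred (A j)) end.
pose R (i : I) : ('I_(ar i) -> K) -> Prop := match i with
  | inl _ => fun=> True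
  | inr j => fun v => rel_of (atom_pred (A j)) [tuple v x | x < arity (atom_pred (A j))]
  end.
have ppR i : pp G (@R i).
  case: i => [z|j] /=; first exact: pp_true.
  apply: pp_ext (pp_atom (ord_tuple _) (bA j)) _ => v.
  by rewrite (_ : map_tuple v _ = [tuple v x | x < arity (atom_pred (A j))]) //;
    apply: eq_from_tnth => x; rewrite tnth_map tnth_mktuple tnth_ord_tuple.
have arQ i : ar i <= maxn q 2.
  by case: i => [z|j] /=; [rewrite leq_max orbT | apply: arity_basic].
pose V := {i : I & 'I_(ar i)}.
pose var (z : Vr) : V := existT (fun i => 'I_(ar i)) (inl z) ord0.
pose occ j (x : 'I_(arity (atom_pred (A j)))) : V :=
  existT (fun i => 'I_(ar i)) (inr j) x.
pose E : seq (V * V) :=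
  [seq (var (tnth (atom_vars (A (tag x))) (tagged x)), occ _ (tagged x))
     | x : {j : 'I_m & 'I_(arity (atom_pred (A j)))}].
have inE' j x : (var (tnth (atom_vars (A j)) x), occ j x) \in E.
  by apply/imageP; exists (existT _ j x).
pose lam i (X : {set 'I_n.+1}) (y : K) := i \in X -> y = a i.
(* Leaf [i] sits at the [i]-th free variable; bound variables and occurrences carry none. *)
pose s (w : V) : tree k 'I_n.+1 'I_n.+1 :=
  match tag w with inl (inl i) => Leaf k i [set: _] | _ => Top end.
have hs w : hard G (maxn q 2) (s w) by rewrite /s; case: (tag w) => [[]|].
pose lamV w X := eval (switch lam X) (s w).
have swV w : switched G a (fun X (z : unit -> K) => lamV w X (z tt)).
  by apply: switched_eval (hs w) => i; apply: switched_leaf.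
have holdsE (v : Vr -> K) j : atom_holds v (A j) =
    rel_of (atom_pred (A j)) [tuple v (tnth (atom_vars (A j)) x) | x < _].
  rewrite /atom_holds; congr (rel_of _ _); apply: eq_from_tnth => x.
  by rewrite tnth_map tnth_mktuple.
have [||P cP eP|[o [Ro Eo] lamo]|x|t [ht cnt unsat sat]] := @resolve _ _ const_G _ a (maxn q 2) _ _
    _ _ _ R ppR arQ E lamV swV.
- by rewrite card_ord.
- by rewrite leq_max orbT.
- by rewrite card_ord; apply: max_p.
- pose zv z := o (var z).
  move/negP: nrt; apply.
  have -> : r tp = rel_of (mkRk r) tp by [].
  rewrite rE; apply/existsP; exists [tuple zv (inr y) | y < l].
  apply/forallP => j; rewrite holdsE; have := Ro (inr j); rewrite /R.
  congr (is_true (rel_of _ _)); apply: eq_from_tnth => x; rewrite !tnth_mktuple.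
  have := Eo _ (inE' j x); rewrite /= => <-.
  case: (tnth (atom_vars (A j)) x) => [i|y] /=; last by rewrite tnth_mktuple.
  by have := lamo (var (inl i)); rewrite /lamV /s /= /switch /lam => ->; rewrite ?inE.
- have [b rb] := relax x.
  have := rE [tuple if i == x then b else tnth tp i | i < n.+1].
  rewrite [rel_of _ _]rb => /esym/existsP[y /forallP holds].
  set zv := assign _ y in holds.
  exists (fun w : V => match w with
    | existT (inl z) _ => zv z
    | existT (inr j) x => zv (tnth (atom_vars (A j)) x) end).
    split=> [[z|j] //=|e /imageP[u _ ->]] //.
    by have := holds j; rewrite holdsE.
  move=> [[[i|y']|j] x'] //=; rewrite /lamV /s /= /switch /lam !inE andbT /=.
  by rewrite tnth_mktuple => /negbTE->.
exists (subst s t); split.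
- exact: hard_subst.
- move=> x; apply: leq_trans (weight_subst (c := 1) _ _) _; last by rewrite muln1.
  by move=> w; rewrite /s; case: (tag w) => [[i|y]|j] //=; rewrite muln1 leq_b1.
- by move=> [y /eval_switch_subst ty]; apply: unsat; exists y.
- by move=> x; have [y ty] := sat x; exists y; apply/eval_switch_subst.
Qed.

Lemma long_chain n (r : rpred k n.+1) :
  pp_closure G (mkRk r) -> essential (mkRk r) ->
  (forall P, pp_closure G P -> essential P -> arity P <= n.+1) ->
  exists m (rho : rpred k m.+2) (r1 : rpred k 2) (rs : 'I_m -> rpred k 3)
      (rn : rpred k 2),
    [/\ pp_closure G (mkRk rho) /\ essential (mkRk rho),
        [/\ pp_closure G (mkRk r1), forall i, pp_closure G (mkRk (rs i)) &
            pp_closure G (mkRk rn)],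
        forall x : (m.+2).-tuple K, rho x = chain r1 rs rn x &
        n.+1 < (k * q) ^ m.+2].
Proof.
move=> clr essr max_p.
have n_gt0 : 0 < n by have [] := rho_eq_essential; apply: max_p.
have [a [t [ht cnt unsat sat]]] := acyclic_essential clr essr max_p.
have kq_gt1 : 1 < k * q by rewrite (leq_trans k_gt1) // leq_pmulr // q_gt0.
have leQ : maxn q 2 <= k * q.
  by rewrite geq_max kq_gt1 leq_pmull // ltnW.
have unsat_a y : ~ eval_at t a y.
  move=> ty; apply: unsat; exists y; apply: eval_mono ty => i B z zE.
  by rewrite /switch setTI.
have sat_c x : exists c y, eval_at t (fun i => if i == x then c else a i) y.
  have [y ty] := sat x; have [c tc] := eval_switch_off (cnt x) ty.
  by exists c, y.
(* A leaf that does not occur could be changed without effect, yet changing any one leaf restores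
   satisfiability. *)
have suppT : leaves t = [set: 'I_n.+1].
  apply/setP => x; rewrite inE; apply: contrapT => /negP nx.
  have [c [y ty]] := sat_c x; apply: (unsat_a y).
  apply: eval_at_leaves ty => i ti; case: eqP => // eq_ix.
  by rewrite eq_ix (negbTE nx) in ti.
have [|mm [s [sz us _ Cs]]] := extract_chain const_G a kq_gt1 leQ ht cnt.
- by rewrite suppT; apply/set0Pn; exists ord0; rewrite inE.
rewrite suppT cardsT card_ord.
(* A chain of length 1 would bound the arity [n.+1] by 1. *)
case: mm sz Cs => [|[|m]] sz Cs; first by case: Cs.
  by rewrite expn0 ltnS leqNgt n_gt0.
move=> /= le_n.
(* One more factor than the extracted bound has makes the inequality strict. *)
have lt_n : n.+1 < (k * q) ^ m.+2.
  by apply: leq_ltn_trans le_n _; rewrite ltn_exp2l.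
have [R [S [ppR ppS CE]]] := chain_form_path Cs.
pose xs (v : 'I_m.+2 -> K) t := v (inord t).
pose P (v : 'I_m.+2 -> K) := exists y, eval_at t (override a s (xs v)) y.
have ppP : pp G P.
  apply: (@pp_exI _ _ _ unit _ (fun z => eval_at t (override a s
    (fun j => z (inl (inord j)))) (z (inr tt)))).
    have := pp_subst const_G (fun x : option 'I_n.+1 => match x with
      | Some i => if i \in s then inl (inl (inord (index i s)) : 'I_m.+2 + unit)
                  else inr (a i)
      | None => inl (inr tt) end) (pp_eval_at ht).
    move/pp_ext; apply => v; split; apply: eval_at_leaves => i _;
      by rewrite /override /=; case: ifP.
  by move=> v; split=> [[y ty]|[y ty]]; [exists (fun=> y) | exists (y tt)].
pose o1 : 'I_3 := Ordinal (isT : 1 < 3).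
exists m, (rpred_of P),
  (* The root variable is quantified inside the first link, which makes that link binary. *)
  (rpred_of (fun v : 'I_2 -> K => exists y, R 0 y (v ord0) (v ord_max))),
  (fun i => rpred_of (fun v : 'I_3 -> K => R i.+1 (v ord0) (v o1) (v ord_max))),
  (rpred_of (fun v : 'I_2 -> K => S (v ord0) (v ord_max))).
split=> //.
- split; first exact: pp_closure_rpred_of.
  have nth_s (j : 'I_m.+2) : nth ord0 s j \in s by rewrite mem_nth ?sz.
  have ovr (c : K) (j0 : 'I_m.+2) v :
      (forall j : 'I_m.+2, v j = if j == j0 then c else a (nth ord0 s j)) ->
      override a s (xs v) =1 fun i => if i == nth ord0 s j0 then c else a i.
    move=> vE i; rewrite /override; case: (boolP (i \in s)) => si; last first.
      by case: eqP => // ii; rewrite ii nth_s in si.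
    have lt_i : index i s < m.+2 by rewrite -sz index_mem.
    have -> : (i == nth ord0 s j0) = (index i s == j0).
      by rewrite -{1}(nth_index ord0 si) nth_uniq ?sz.
    by rewrite /xs vE -val_eqE /= inordK // nth_index.
  (* The constants of the chosen leaves form a critical tuple, as the other leaves are fixed to
     theirs. *)
  apply: (@critical_essential _ _ _ [tuple a (nth ord0 s j) | j < m.+2]).
    rewrite ffunE; apply/asboolPn => -[y ty]; apply: (unsat_a y).
    apply: eval_at_leaves ty => i _.
    rewrite (ovr (a (nth ord0 s (@ord0 m.+1))) ord0).
      by case: eqP => // ->.
    by move=> j; rewrite tnth_mktuple; case: eqP => // ->.
  move=> j; have [c [y ty]] := sat_c (nth ord0 s j); exists c.
  rewrite ffunE; apply/asboolP; exists y; apply: eval_at_leaves ty => i _.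
  by rewrite (ovr c j) // => j'; rewrite !tnth_mktuple.
- split; try by move=> *; apply: pp_closure_rpred_of.
  apply: pp_closure_rpred_of.
  apply: (@pp_exI _ _ _ unit _ (fun z => R 0 (z (inr tt)) (z (inl ord0)) (z (inl ord_max)))).
    exact: (pp_sub (fun i : 'I_3 => if i == ord0 then inr tt
      else if i == o1 then inl ord0 else inl ord_max) (ppR 0)).
  by move=> v; split=> [[y Ry]|[y Ry]]; [exists (fun=> y) | exists (y tt)].
have T2 (b0 b1 : K) : (tnth [tuple b0; b1] ord0 = b0) *
    (tnth [tuple b0; b1] ord_max = b1) by rewrite !(tnth_nth b0).
have T3 (b0 b1 b2 : K) : (tnth [tuple b0; b1; b2] ord0 = b0) *
    (tnth [tuple b0; b1; b2] o1 = b1) * (tnth [tuple b0; b1; b2] ord_max = b2).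
  by rewrite !(tnth_nth b0).
have inord0 j : inord 0 = ord0 :> 'I_j.+1 by apply: val_inj; rewrite /= inordK.
have inord_max j : inord j = ord_max :> 'I_j.+1 by apply: val_inj; rewrite /= inordK.
move=> x; rewrite ffunE; apply/asboolP/existsP.
  move=> [y /CE[w [w0 Rw Sw]]]; exists [tuple w j.+1 | j < m.+1].
  apply/and3P; split.
  - rewrite ffunE; apply/asboolP; exists (w 0).
    by have := Rw 0 isT; rewrite /xs inord0 !T2 tnth_mktuple.
  - apply/forallP => i; rewrite ffunE; apply/asboolP.
    have := Rw i.+1 (ltn_ord i).
    by rewrite !T3 !tnth_mktuple !inordK // ltnS // ltnW.
  - rewrite ffunE; apply/asboolP; move: Sw.
    by rewrite !T2 tnth_mktuple /xs inord_max.
move=> [y /and3P[]].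
rewrite !ffunE => /asboolP[z Rz] /forallP Rs /asboolP Sy.
exists z; apply/CE; exists (fun j => if j is j'.+1 then tnth y (inord j') else z).
split=> // [[|j] lt_j|].
- by move: Rz; rewrite !T2 /xs !inord0.
- by have := Rs (Ordinal (lt_j : j < m)); rewrite ffunE => /asboolP; rewrite !T3.
by move: Sy; rewrite !T2 /xs !inord_max.
Qed.

End Main.

(* The bound in logarithmic form *)
From mathcomp Require Import all_order all_algebra.
From mathcomp Require Import classical_sets functions cardinality.
From mathcomp Require Import reals exp.

Import Order.TTheory GRing.Theory Num.Theory.

Local Open Scope classical_set_scope.

Theorem theorem5 (R : realType) (k : nat) (hk : 2 <= k) (G : set (Rk k))
    (p q : nat)
    (hG : forall a : 'I_k, G (rho_eq_const a))
    (hfin : finite_set [set P | pp_closure G P /\ essential P])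
    (hp : is_ar [set P | pp_closure G P /\ essential P] p)
    (hq : is_ar G q) :
  exists (m : nat) (rho : rpred k m.+2)
         (r1 : rpred k 2) (r : 'I_m -> rpred k 3) (rn : rpred k 2),
    [/\ pp_closure G (mkRk rho) /\ essential (mkRk rho),
        [/\ pp_closure G (mkRk r1), forall i, pp_closure G (mkRk (r i)) &
            pp_closure G (mkRk rn)],
        forall x : (m.+2).-tuple 'I_k, rho x = chain r1 r rn x &
        (logb ((k * q)%N%:R : R) (p%:R : R) < (m.+2)%:R)%R].
Proof.
case: hp hq => [[[n r] [clr essr] np] max_p] [_ arity_G].
rewrite /arity /= in np.
(* The arity [p] is not 0, as equality is an essential predicate of arity 2. *)
case: n r np clr essr => [|n] r np clr essr.
  have [] := rho_eq_essential G hk => cle esse.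
  by have := max_p (rho_eq k) (conj cle esse); rewrite -np.
have maxn1 P : pp_closure G P -> essential P -> arity P <= n.+1.
  by move=> cP eP; rewrite np; apply: max_p.
have [m [rho [r1 [rs [rn [rhoP chainP rhoE lt_n]]]]]] :=
  long_chain hG hk arity_G clr essr maxn1.
exists m, rho, r1, rs, rn; split=> //.
have kq_gt1 : (1 < (k * q)%N%:R :> R)%R.
  by rewrite ltr1n (leq_trans hk) // leq_pmulr // (q_gt0 hG hk arity_G).
have kq_gt0 : (0 < (k * q)%N%:R :> R)%R by apply: lt_trans kq_gt1.
(* As [k * q > 1], its logarithm is positive, and monotonicity of [ln] reduces the claim to
   [p < (k * q) ^ m.+2]. *)
rewrite /logb ltr_pdivrMr ?ln_gt0 // mulr_natl -lnXn // ltr_ln ?posrE //.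
- by rewrite -np -natrX ltr_nat.
- by rewrite -np ltr0n.
- exact: exprn_gt0.
Qed.
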